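(* Let $\mathcal{A}$ be a separable unital AF C*-algebra, let $\mathcal{B}$ be a unital C*-algebra with property HUC, and let $\pi\in\mathrm{Rep}(\mathcal{A},\mathcal{B})$. Then $\mathcal{U}_{\mathcal{B}}(\pi)^-$ is path-connected.
   Context: For unital C*-algebras $\mathcal{A},\mathcal{B}$ with $\mathcal{A}$ separable, $\mathrm{Rep}(\mathcal{A},\mathcal{B})$ is the set of unital $*$-homomorphisms $\mathcal{A}\to\mathcal{B}$ with the topology of pointwise norm convergence. $\mathcal{U}_{\mathcal{B}}$ is the unitary group of $\mathcal{B}$, $\mathcal{U}_{\mathcal{B}}(\pi)=\{U^*\pi(\cdot)U:U\in\mathcal{U}_{\mathcal{B}}\}$, and $\mathcal{U}_{\mathcal{B}}(\pi)^-$ is its closure in $\mathrm{Rep}(\mathcal{A},\mathcal{B})$. A unital C*-algebra $\mathcal{B}$ has property UC if $\mathcal{U}_{\mathcal{B}}$ is connected, and property HUC if for every projection $P\in\mathcal{B}$ the corner $P\mathcal{B}P$ has property UC. *)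

(* Defs.v *)
From HB Require Import structures.
From mathcomp Require Import all_boot all_order all_algebra.
From mathcomp Require Import all_classical all_reals all_analysis.
From mathcomp Require Import complex.
Set Implicit Arguments. Unset Strict Implicit. Unset Printing Implicit Defensive.
Import Order.TTheory GRing.Theory Num.Theory.
Import numFieldNormedType.Exports.
Local Open Scope classical_set_scope.
Local Open Scope ring_scope.

(* The complex field is R[i] for a realType R (complete, i.e. a copy of C).
   A unital C*-algebra is a complete normed complex vector space A (Banach
   space) equipped with an associative bilinear multiplication with unit,
   and an involution, such that the norm is submultiplicative and the
   C*-identity holds. *)
Record cstar_structure (R : realType) (A : completeNormedModType R[i]) := {
  cmul : A -> A -> A;
  cone : A;
  cstar : A -> A;
  cmulA : forall x y z, cmul x (cmul y z) = cmul (cmul x y) z;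
  cmul1l : forall x, cmul cone x = x;
  cmul1r : forall x, cmul x cone = x;
  cmulDl : forall x y z, cmul (x + y) z = cmul x z + cmul y z;
  cmulDr : forall x y z, cmul x (y + z) = cmul x y + cmul x z;
  cmulZl : forall (a : R[i]) x y, cmul (a *: x) y = a *: cmul x y;
  cmulZr : forall (a : R[i]) x y, cmul x (a *: y) = a *: cmul x y;
  cstarD : forall x y, cstar (x + y) = cstar x + cstar y;
  cstarZ : forall (a : R[i]) x, cstar (a *: x) = (a^*)%C *: cstar x;
  cstarM : forall x y, cstar (cmul x y) = cmul (cstar y) (cstar x);
  cstarK : forall x, cstar (cstar x) = x;
  cnormM : forall x y, `|cmul x y| <= `|x| * `|y|;
  cstar_identity : forall x, `|cmul (cstar x) x| = `|x| ^+ 2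
}.

Section Defs.
Variable R : realType.

(* separable: has a countable dense subset *)
Definition separable (A : completeNormedModType R[i]) : Prop :=
  exists f : nat -> A, closure (range f) = setT.

(* linear span of a finite list *)
Definition span_seq (A : completeNormedModType R[i]) (s : seq A) : set A :=
  [set x | exists c : 'I_(size s) -> R[i],
             x = \sum_(i < size s) c i *: s`_i].

(* finite-dimensional *-subalgebra (a finite-dimensional subspace is
   automatically norm-closed, so this is a finite-dimensional
   C*-subalgebra) *)
Definition fd_star_subalgebra (A : completeNormedModType R[i])
  (SA : cstar_structure A) (D : set A) : Prop :=
  (exists s : seq A, D = span_seq s) /\
  (forall x y, D x -> D y -> D (cmul SA x y)) /\
  (forall x, D x -> D (cstar SA x)).

(* AF: the closure of the union of an increasing sequence of
   finite-dimensional C*-subalgebras is the whole algebra *)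
Definition AF (A : completeNormedModType R[i]) (SA : cstar_structure A)
  : Prop :=
  exists D : nat -> set A,
    (forall n, fd_star_subalgebra SA (D n)) /\
    (forall n, D n `<=` D n.+1) /\
    closure (\bigcup_n D n) = setT.

Definition unitary_group (B : completeNormedModType R[i])
  (SB : cstar_structure B) : set B :=
  [set U | cmul SB (cstar SB U) U = cone SB /\ cmul SB U (cstar SB U) = cone SB].

(* property UC *)
Definition UC (B : completeNormedModType R[i]) (SB : cstar_structure B)
  : Prop := connected (unitary_group SB).

Definition is_projection (B : completeNormedModType R[i])
  (SB : cstar_structure B) (P : B) : Prop :=
  cmul SB P P = P /\ cstar SB P = P.

(* unitary group of the corner P B P (a unital C*-algebra with unit P),
   viewed as a subset of B (its norm topology is the subspace topology) *)
Definition corner_unitary_group (B : completeNormedModType R[i])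
  (SB : cstar_structure B) (P : B) : set B :=
  [set u | u = cmul SB (cmul SB P u) P /\
           cmul SB (cstar SB u) u = P /\ cmul SB u (cstar SB u) = P].

(* property HUC: every corner P B P has property UC *)
Definition HUC (B : completeNormedModType R[i]) (SB : cstar_structure B)
  : Prop :=
  forall P : B, is_projection SB P -> connected (corner_unitary_group SB P).

(* unital *-homomorphisms *)
Definition unital_star_hom (A B : completeNormedModType R[i])
  (SA : cstar_structure A) (SB : cstar_structure B) (f : A -> B) : Prop :=
  (forall x y, f (x + y) = f x + f y) /\
  (forall (a : R[i]) x, f (a *: x) = a *: f x) /\
  (forall x y, f (cmul SA x y) = cmul SB (f x) (f y)) /\
  (forall x, f (cstar SA x) = cstar SB (f x)) /\
  f (cone SA) = cone SB.

(* Rep(A,B), inside the space of functions A -> B with the topology of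
   pointwise norm convergence *)
Definition Rep (A B : completeNormedModType R[i])
  (SA : cstar_structure A) (SB : cstar_structure B) : set {ptws A -> B} :=
  [set f | unital_star_hom SA SB f].

(* U_B(pi) *)
Definition unitary_orbit (A B : completeNormedModType R[i])
  (SB : cstar_structure B) (pi : A -> B) : set {ptws A -> B} :=
  [set f | exists U, unitary_group SB U /\
             f = (fun a => cmul SB (cmul SB (cstar SB U) (pi a)) U)].

(* U_B(pi)^- : closure of U_B(pi) in Rep(A,B) *)
Definition unitary_orbit_closure (A B : completeNormedModType R[i])
  (SA : cstar_structure A) (SB : cstar_structure B) (pi : A -> B)
  : set {ptws A -> B} :=
  closure (unitary_orbit SB pi) `&` Rep SA SB.

End Defs.

(* path-connectedness of a subset of a topological space *)
Definition path_connected (R : realType) (T : topologicalType) (S : set T)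
  : Prop :=
  forall x y, S x -> S y ->
    exists f : R -> T,
      {within `[0, 1]%classic, continuous f} /\ f 0 = x /\ f 1 = y /\
      f @` `[0, 1]%classic `<=` S.

(* Main.v *)
Require Import Defs.
From HB Require Import structures.
From mathcomp Require Import all_boot all_order all_algebra.
From mathcomp Require Import all_classical all_reals all_analysis.
From mathcomp Require Import complex.
From mathcomp Require Import ring lra.

(* Write the AF algebra as the closure of an increasing sequence of finite-dimensional
   unital *-subalgebras D_n, and let x, y lie in the closure of the orbit.  On D_n close
   homomorphisms are unitarily equivalent, so y = V_n^* x V_n on D_n for some unitary V_n, and
   V_(n+1) V_n^* commutes with x(D_n).  The commutant of x(D_n) is a direct sum of corners of B
   (cut out by the images of minimal projections of D_n), so HUC yields a path W_n(t) of
   unitaries in it from 1 to V_(n+1) V_n^*.  With W(t) a path from 1 to V_0 and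
   G_n(t) = W_(n-1)(t) ... W_0(t) W(t), the homomorphisms G_n(t)^* x G_n(t) are eventually
   constant on each D_n, uniformly in t, hence converge uniformly in t; the limit is a path
   from x to y, with no concatenation of paths. *)

(** The [V_n] need not converge, and no single unitary need carry x to y on the whole algebra, so
    the path is built among homomorphisms: the conjugates of x by [G_n(t)] converge although the
    [G_n(t)] themselves may not. Since [W_n(t)] commutes with x on [D_n], inserting it does not
    disturb what was already arranged there; this is why connectedness is needed in corners and not
    only in the whole algebra. Contractivity of *-homomorphisms then turns agreement on the dense
    union into convergence uniform in t. HUC gives connectedness only. Unitaries of a corner at
    distance less than 1 are joined by an explicit path, so the set reachable from the unit of the
    corner is relatively open and closed. All spectral arguments rest on one tool, the square root
    of [1 - x] for x of norm less than 1, obtained as a fixed point. Its uniqueness makes it inherit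
    self-adjointness, and the same estimate makes it commute with whatever commutes with x. It
    yields polar parts, short unitary paths and contractivity. In the finite-dimensional part,
    Cayley-Hamilton supplies the spectral projections. *)

Set Implicit Arguments. Unset Strict Implicit. Unset Printing Implicit Defensive.
Import Order.TTheory GRing.Theory Num.Theory.
Import numFieldNormedType.Exports.
Local Open Scope classical_set_scope.
Local Open Scope ring_scope.

(* A copy of [A] on which the product of [SA] is the canonical ring structure. *)
Definition calg (R : realType) (A : completeNormedModType R[i])
  (SA : cstar_structure A) : Type := A.

Section CstarRing.
Variables (R : realType) (A : completeNormedModType R[i]) (SA : cstar_structure A).

HB.instance Definition _ := CompleteNormedModule.on (calg SA).
HB.instance Definition _ := @GRing.Zmodule_isPzRing.Build (calg SA)
  (cone SA) (cmul SA) (cmulA SA) (cmul1l SA) (cmul1r SA) (cmulDl SA) (cmulDr SA).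

End CstarRing.

(** * The norm as a real number *)

Section Norm.
Variables (R : realType) (A : completeNormedModType R[i]).
Implicit Types (x y z : A) (a : R[i]).

(** The norm of the structure takes values in [R[i]]; by [normE] nothing is lost by passing to [R],
    where [lra] and [nra] apply. *)
Definition nrm x : R := complex.Re `|x|.

Lemma normE x : `|x| = (nrm x)%:C%C.
Proof. by rewrite /nrm RRe_real// ger0_real. Qed.

Lemma nrm_ge0 x : 0 <= nrm x.
Proof. by rewrite -ler0c -normE. Qed.

Lemma nrm_eq0 x : nrm x = 0 -> x = 0.
Proof. by move=> h; apply/eqP; rewrite -normr_eq0 normE h. Qed.

Lemma nrm0 : nrm 0 = 0.
Proof. by rewrite /nrm normr0. Qed.

Lemma nrmN x : nrm (- x) = nrm x.
Proof. by rewrite /nrm normrN. Qed.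

Lemma nrm_distC x y : nrm (x - y) = nrm (y - x).
Proof. by rewrite /nrm distrC. Qed.

Lemma nrmD x y : nrm (x + y) <= nrm x + nrm y.
Proof. by rewrite -lecR rmorphD /= -!normE ler_normD. Qed.

Lemma nrmB x y : nrm (x - y) <= nrm x + nrm y.
Proof. by rewrite -(nrmN y) nrmD. Qed.

Lemma nrm_dist_le z x y : nrm (x - y) <= nrm (x - z) + nrm (z - y).
Proof. by rewrite -[x - y](subrKA z) nrmD. Qed.

Lemma nrmZ a x : nrm (a *: x) = complex.Re `|a| * nrm x.
Proof.
have -> : nrm (a *: x) = complex.Re (`|a| * `|x|) by rewrite /nrm normrZ.
have /complex_realP[r ->] : `|a| \is Num.real by rewrite ger0_real.
by rewrite normE -rmorphM.
Qed.

Lemma nrmZr (r : R) x : nrm (r%:C%C *: x) = `|r| * nrm x.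
Proof. by rewrite nrmZ normc_def /= expr0n addr0 sqrtr_sqr. Qed.

Lemma nrm_small_eq0 x : (forall e, 0 < e -> nrm x <= e) -> x = 0.
Proof.
move=> h; apply: nrm_eq0; apply/eqP; rewrite eq_le nrm_ge0 andbT.
by apply/ler_addgt0Pr => e e0; rewrite add0r h.
Qed.

Lemma nrm_sum I (s : seq I) (P : pred I) (F : I -> A) :
  nrm (\sum_(i <- s | P i) F i) <= \sum_(i <- s | P i) nrm (F i).
Proof.
elim/big_rec2 : _ => [|i y x _ h]; first by rewrite nrm0.
by rewrite (le_trans (nrmD _ _))// lerD2l.
Qed.

Lemma nrm_cauchy (u : nat -> A) :
  (forall e : R, 0 < e -> exists N, forall n, (N <= n)%N -> nrm (u n - u N) < e) ->
  exists l, forall e : R, 0 < e -> exists N, forall n, (N <= n)%N -> nrm (u n - l) < e.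
Proof.
move=> uC.
have cu : cvgn u.
  apply/cauchy_cvgP/cauchy_ballP => e e0.
  have er : 0 < complex.Re e / 2 
    by move: e0; case: e => a b; rewrite ltcE/= => /andP[_ ?]; rewrite divr_gt0.
  have eE : e = (complex.Re e)%:C%C by rewrite RRe_real// gtr0_real.
  have [N hN] := uC _ er.
  exists (u @` [set n | (N <= n)%N], u @` [set n | (N <= n)%N]).
    split; exists N => // n /= Nn; by exists n.
  move=> [_ _] [/= [n Nn <-] [m Nm <-]].
  rewrite /ball_ -ball_normE /ball_/= normE eE ltcR.
  have := nrm_dist_le (u N) (u n) (u m).
  have := hN _ Nn; have := hN _ Nm; rewrite (nrm_distC (u m)); lra.
exists (limn u) => e e0.
have /cvgrPdist_lt/(_ e%:C%C) := cu.
rewrite ltcR => /(_ e0) [N _ hN]; exists N => n Nn.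
by have := hN n Nn; rewrite /= normE ltcR nrm_distC.
Qed.

End Norm.

(** * Algebra in a C*-algebra *)

Section Algebra.
Variables (R : realType) (A : completeNormedModType R[i]) (SA : cstar_structure A).
Local Notation T := (calg SA).
Implicit Types (x y z u v w : T) (a : R[i]).

Definition star x : T := cstar SA x.

Lemma starD x y : star (x + y) = star x + star y. Proof. exact: (cstarD SA). Qed.
Lemma starZ a x : star (a *: x) = (a^*)%C *: star x. Proof. exact: (cstarZ SA). Qed.
Lemma starM x y : star (x * y) = star y * star x. Proof. exact: (cstarM SA). Qed.
Lemma starK x : star (star x) = x. Proof. exact: (cstarK SA). Qed.

Lemma starZr (r : R) x : star (r%:C%C *: x) = r%:C%C *: star x.
Proof. by rewrite starZ conjc_real. Qed.

Lemma starZi x : star ('i%C *: x) = - ('i%C *: star x).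
Proof. by rewrite starZ -scaleNr; congr (_ *: _); apply/eqP; rewrite eq_complex /= oppr0 !eqxx. Qed.

Lemma star0 : star 0 = 0.
Proof. by rewrite -(scale0r (0 : T)) starZ conjc0 !scale0r. Qed.

Lemma starN x : star (- x) = - star x.
Proof. by apply/eqP; rewrite -addr_eq0 -starD addNr star0. Qed.

Lemma starB x y : star (x - y) = star x - star y.
Proof. by rewrite starD starN. Qed.

Lemma star1 : star 1 = 1.
Proof. by rewrite -[LHS]mulr1 -{2}(starK 1) -starM mulr1 starK. Qed.

Lemma star_sum I (s : seq I) (P : pred I) (F : I -> T) :
  star (\sum_(i <- s | P i) F i) = \sum_(i <- s | P i) star (F i).
Proof. exact: (big_morph star starD star0). Qed.

Lemma scale_mull a x y : (a *: x) * y = a *: (x * y).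
Proof. exact: (cmulZl SA). Qed.

Lemma scale_mulr a x y : x * (a *: y) = a *: (x * y).
Proof. exact: (cmulZr SA). Qed.

Lemma nrmM x y : nrm (x * y) <= nrm x * nrm y.
Proof. by rewrite -lecR rmorphM /= -!normE; exact: (cnormM SA). Qed.

Lemma nrm_starM x : nrm (star x * x) = nrm x ^+ 2.
Proof.
apply: complexI; rewrite rmorphXn /= -!normE; exact: (cstar_identity SA).
Qed.

(** The C*-identity and submultiplicativity bound the square of [nrm y] by [nrm (star y) * nrm y];
    cancel, then exchange [y] and [star y]. *)
Lemma nrm_star x : nrm (star x) = nrm x.
Proof.
have le (y : T) : nrm y <= nrm (star y).
  have := nrm_starM y; have := nrmM (star y) y.
  have [->|y0] := eqVneq (nrm y) 0; first by rewrite nrm_ge0.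
  have yp : 0 < nrm y by rewrite lt_def y0 nrm_ge0.
  by move=> /[swap] ->; rewrite expr2 ler_pM2r.
by apply/eqP; rewrite eq_le -{2}(starK x) !le.
Qed.

Lemma star_mul_eq0 x : star x * x = 0 -> x = 0.
Proof.
move=> h; have := nrm_starM x; rewrite h nrm0 => /esym/eqP.
by rewrite sqrf_eq0 => /eqP/nrm_eq0.
Qed.

Definition projection (p : T) := p * p = p /\ star p = p.
Definition unitary (u : T) := star u * u = 1 /\ u * star u = 1.

Lemma nrm_projection_le1 p : projection p -> nrm p <= 1.
Proof.
move=> [pp sp]; have := nrm_starM p; rewrite sp pp.
have := nrm_ge0 p => p0 h.
have : nrm p * (nrm p - 1) = 0 by rewrite mulrBr mulr1 -expr2 -h subrr.
by move=> /eqP; rewrite mulf_eq0 subr_eq0 => /orP[] /eqP ->.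
Qed.

Lemma projection1 : projection 1.
Proof. by split; [rewrite mulr1|rewrite star1]. Qed.

Lemma nrm_isometry_le1 p v : projection p -> star v * v = p -> nrm v <= 1.
Proof.
move=> Pp vp; have := nrm_projection_le1 Pp.
by rewrite -vp nrm_starM expr_le1// nrm_ge0.
Qed.

Lemma nrm_unitary_le1 u : unitary u -> nrm u <= 1.
Proof. by case=> uu _; exact: (nrm_isometry_le1 projection1 uu). Qed.

Lemma unitaryM u v : unitary u -> unitary v -> unitary (u * v).
Proof.
move=> [u1 u2] [v1 v2]; split; rewrite starM.
  by rewrite mulrA -(mulrA _ _ u) u1 mulr1.
by rewrite mulrA -(mulrA u) v2 mulr1.
Qed.

Lemma unitary_star u : unitary u -> unitary (star u).
Proof. by move=> [u1 u2]; split; rewrite starK. Qed.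

Lemma nrm_conj u x : unitary u -> nrm (star u * x * u) <= nrm x.
Proof.
move=> uu; rewrite (le_trans (nrmM _ _))// (le_trans (y := nrm (star u * x) * 1))//.
  by rewrite ler_wpM2l ?nrm_ge0 ?nrm_unitary_le1.
rewrite mulr1 (le_trans (nrmM _ _))// -[leRHS]mul1r ler_wpM2r ?nrm_ge0//.
by rewrite nrm_star nrm_unitary_le1.
Qed.

Lemma nrm_le_mul r s x y : nrm x <= r -> nrm y <= s -> nrm (x * y) <= r * s.
Proof.
by move=> xr ys; rewrite (le_trans (nrmM _ _))// ler_pM ?nrm_ge0.
Qed.

Lemma nrm_double x : nrm (x + x) = 2 * nrm x.
Proof.
have -> : x + x = (2 : R)%:C%C *: x by rewrite -mulr2n -scaler_nat rmorph_nat.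
by rewrite nrmZr ger0_norm.
Qed.

(** Banach's theorem on the closed ball of radius [r], iterating from 0. The ball itself bounds the
    first gap by [r], which gives the geometric estimate [uq]. *)
Lemma contraction_fixpoint (F : T -> T) (r q : R) : 0 <= r -> 0 <= q -> q < 1 ->
  (forall x, nrm x <= r -> nrm (F x) <= r) ->
  (forall x y, nrm x <= r -> nrm y <= r -> nrm (F x - F y) <= q * nrm (x - y)) ->
  exists p, nrm p <= r /\ p = F p.
Proof.
move=> r0 q0 q1 Fr Fq; pose u n := iter n F 0.
have ur n : nrm (u n) <= r by elim: n => [|n IH] /=; rewrite ?nrm0// Fr.
have uq n m : nrm (u (n + m)%N - u n) <= q ^+ n * r.
  elim: n => [|n IH]; first by rewrite add0n expr0 mul1r /= subr0.
  by rewrite addSn /= (le_trans (Fq _ _ _ _))// exprS -mulrA ler_wpM2l.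
have small e : 0 < e -> exists N, q ^+ N * r < e.
  move=> e0; have qe : `|q| < 1 by rewrite ger0_norm.
  have e1 : 0 < e / (r + 1) by rewrite divr_gt0// ltr_wpDl.
  have /cvgrPdist_lt/(_ _ e1)[N _ hN] := cvg_expr qe.
  exists N; have := hN N (leqnn N); rewrite /= sub0r normrN normrX ger0_norm//.
  rewrite ltr_pdivlMr ?ltr_wpDl// => h; apply: le_lt_trans h.
  by rewrite ler_wpM2l ?exprn_ge0// lerDl.
have [p hp] : exists p, forall e : R, 0 < e ->
    exists N, forall n, (N <= n)%N -> nrm (u n - p) < e.
  apply: nrm_cauchy => e e0; have [N hN] := small e e0.
  by exists N => n /subnKC <-; rewrite (le_lt_trans (uq _ _)).
have pr : nrm p <= r.
  apply/ler_addgt0Pr => e e0; have [N /(_ N (leqnn N)) hN] := hp e e0.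
  have := nrmB (u N) (u N - p); rewrite subKr; have := ur N; lra.
exists p; split=> //; apply/eqP; rewrite -subr_eq0; apply/eqP/nrm_small_eq0 => e e0.
have e2 : 0 < e / 2 by rewrite divr_gt0.
have [N hN] := hp _ e2.
have := nrm_dist_le (u N.+1) p (F p).
have := hN N.+1 (leqnSn N); have := hN N (leqnn N).
have := Fq (u N) p (ur N) pr; rewrite (nrm_distC p (u N.+1)) /= -/(u N).
have : q * nrm (u N - p) <= nrm (u N - p) by rewrite ler_piMl ?nrm_ge0// ltW.
lra.
Qed.

(* [y + y = x + y * y] says that [1 - y] is a square root of [1 - x]. *)
Lemma sqrt_exists x (q : R) : 0 <= q -> q < 1 -> nrm x <= q ->
  exists y, nrm y <= q /\ y + y = x + y * y.
Proof.
move=> q0 q1 xq; pose h : R[i] := (2^-1 : R)%:C%C.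
have hh z : h *: (z + z) = z.
  rewrite scalerDr -scalerDl -rmorphD /=.
  have -> : (2^-1 + 2^-1 : R) = 1 by field.
  by rewrite rmorph1 scale1r.
have hn z : nrm (h *: z) = 2^-1 * nrm z by rewrite nrmZr ger0_norm.
have [||y [yq yE]] := @contraction_fixpoint (fun y => h *: (x + y * y)) q q q0 q0 q1.
- move=> y yq; rewrite hn.
  have := nrmD x (y * y); have := nrm_le_mul yq yq; nra.
- move=> y z yq zq; rewrite -scalerBr hn opprD addrACA subrr add0r.
  have -> : y * y - z * z = y * (y - z) + (y - z) * z.
    by rewrite mulrBr mulrBl subrKA.
  have := nrmD (y * (y - z)) ((y - z) * z).
  have := nrm_le_mul yq (lexx (nrm (y - z))).
  have := nrm_le_mul (lexx (nrm (y - z))) zq; lra.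
exists y; split=> //; rewrite {1 2}yE.
by rewrite -scalerDr hh.
Qed.

(** Subtracting the equations, [d = y - y'] satisfies [d + d = (x - x') + (y * d + d * y')]. This
    gives uniqueness of the root when [x = x'], and later the Lipschitz constant of a path of
    roots. *)
Lemma sqrt_lipschitz x x' y y' (q : R) : nrm y <= q -> nrm y' <= q ->
  y + y = x + y * y -> y' + y' = x' + y' * y' ->
  2 * (1 - q) * nrm (y - y') <= nrm (x - x').
Proof.
move=> yq yq' E E'.
have d : (y - y') + (y - y') = (x - x') + (y * (y - y') + (y - y') * y').
  by rewrite addrACA -opprD E E' mulrBr mulrBl subrKA opprD addrACA.
have := nrm_double (y - y'); rewrite d.
have := nrmD (x - x') (y * (y - y') + (y - y') * y').
have := nrmD (y * (y - y')) ((y - y') * y').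
have := nrm_le_mul yq (lexx (nrm (y - y'))).
have := nrm_le_mul (lexx (nrm (y - y'))) yq'; lra.
Qed.

Lemma sqrt_unique x y y' (q : R) : q < 1 -> nrm y <= q -> nrm y' <= q ->
  y + y = x + y * y -> y' + y' = x + y' * y' -> y = y'.
Proof.
move=> q1 yq yq' E E'; apply/eqP; rewrite -subr_eq0; apply/eqP/nrm_eq0.
have := sqrt_lipschitz yq yq' E E'; rewrite subrr nrm0.
have := nrm_ge0 (y - y'); nra.
Qed.

Lemma sqrt_star x y (q : R) : q < 1 -> nrm y <= q -> y + y = x + y * y ->
  star x = x -> star y = y.
Proof.
move=> q1 yq E sx; apply: (sqrt_unique q1 _ yq _ E); first by rewrite nrm_star.
by rewrite -starD E starD starM sx.
Qed.

(** The commutator [d] of [z] and [y] satisfies [d + d = d * y + y * d], so [nrm d <= q * nrm d] and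
    [d] vanishes. *)
Lemma sqrt_commute x y z (q : R) : q < 1 -> nrm y <= q -> y + y = x + y * y ->
  z * x = x * z -> z * y = y * z.
Proof.
move=> q1 yq E zx; apply/eqP; rewrite -subr_eq0; apply/eqP/nrm_eq0.
set d := z * y - y * z.
have dd : d + d = d * y + y * d.
  rewrite /d addrACA -opprD -mulrDr -mulrDl E mulrDr mulrDl zx.
  rewrite opprD addrACA subrr add0r mulrBl mulrBr.
  by rewrite !mulrA subrKA.
have := nrm_double d; rewrite dd.
have := nrmD (d * y) (y * d).
have := nrm_le_mul yq (lexx (nrm d)); have := nrm_le_mul (lexx (nrm d)) yq.
have := nrm_ge0 d; nra.
Qed.

Lemma sqrt_sq x y : y + y = x + y * y -> (1 - y) * (1 - y) = 1 - x.
Proof.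
move=> E; have -> : x = y + y - y * y by rewrite E addrK.
by rewrite mulrBl mul1r mulrBr mulr1 -addrA -opprD addrA.
Qed.

(** The right inverse is the fixed point of [y |-> 1 + x * y]. It is also a left inverse because the
    commutator [d = y * x - x * y] satisfies [d = x * d], hence is 0. *)
Lemma neumann x (q : R) : 0 <= q -> q < 1 -> nrm x <= q ->
  exists y, (1 - x) * y = 1 /\ y * (1 - x) = 1.
Proof.
move=> q0 q1 xq.
have [r0 rE] : 0 <= (1 - q)^-1 /\ (1 - q)^-1 = 1 + q * (1 - q)^-1.
  split; first by rewrite invr_ge0 subr_ge0 ltW.
  by field; rewrite subr_eq0 eq_sym lt_eqF.
have [||y [_ yE]] := @contraction_fixpoint (fun y => 1 + x * y) _ q r0 q0 q1.
- move=> y yr; rewrite [leRHS]rE (le_trans (nrmD _ _))// lerD//.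
    exact: nrm_projection_le1 projection1.
  exact: nrm_le_mul.
- move=> y z _ _; rewrite opprD addrACA subrr add0r -mulrBr.
  exact: nrm_le_mul.
have E1 : (1 - x) * y = 1 by rewrite mulrBl mul1r {1}yE addrK.
exists y; split=> //; rewrite -[RHS]E1 mulrBl mulrBr mul1r mulr1; congr (_ - _).
apply/eqP; rewrite -subr_eq0; apply/eqP/nrm_eq0.
have d : y * x - x * y = x * (y * x - x * y).
  have e1 : y * x = x + x * (y * x) by rewrite {1}yE mulrDl mul1r mulrA.
  have e2 : x * y = x + x * (x * y) by rewrite {1}yE mulrDr mulr1.
  by rewrite {1}e1 {1}e2 mulrBr opprD addrACA subrr add0r.
have := nrm_le_mul xq (lexx (nrm (y * x - x * y))); rewrite -d.
have := nrm_ge0 (y * x - x * y); nra.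
Qed.

End Algebra.

(** * Unitaries near the identity *)

Section Unitaries.
Variables (R : realType) (A : completeNormedModType R[i]) (SA : cstar_structure A).
Local Notation T := (calg SA).
Implicit Types (x y z u v w V : T) (r s t : R).

Lemma inverse_commute (k l a : T) : k * l = 1 -> l * k = 1 ->
  a * k = k * a -> a * l = l * a.
Proof.
by move=> kl lk ak; rewrite -[LHS]mul1r -lk -mulrA (mulrA k) -ak -!mulrA kl mulr1.
Qed.

(** For [a] self-adjoint and [b] skew-adjoint, [a - b] is the adjoint of [a + b]; this is how
    unitarity is checked below. *)
Lemma diff_squares_comm (a b : T) : b * a = a * b ->
  (a - b) * (a + b) = a * a - b * b /\ (a + b) * (a - b) = a * a - b * b.
Proof.
move=> ba; split; first by rewrite mulrBl !mulrDr ba addrKA.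
by rewrite mulrDl !mulrBr ba addrA subrK.
Qed.

(** The unitary is the polar part [V * l], where [l] inverts the square root [k] of [star V * V].
    The bound [8^-1] keeps [star V * V] within 1/4 + 1/64, so within 1/2, of 1. The two intertwining
    hypotheses together make [a] commute with [star V * V], hence with [k] and [l]. *)
Lemma polar_unitary V : nrm (V - 1) <= 8^-1 ->
  exists U, unitary U /\
    forall a b, V * a = b * V -> V * star a = star b * V -> U * a = b * U.
Proof.
move=> Vq; pose e := V - 1; have VE : V = 1 + e by rewrite addrC subrK.
pose x : T := 1 - star V * V.
have xE : x = - (star e + (e + star e * e)).
  rewrite /x VE starD star1 mulrDl mul1r mulrDr mulr1 -addrA opprD addrA subrr.
  by rewrite sub0r addrCA.
have x2 : nrm x <= 2^-1.
  rewrite xE nrmN; have := nrmD (star e) (e + star e * e).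
  have := nrmD e (star e * e); have := nrm_starM e; have := nrm_star e.
  have := nrm_ge0 e; move: Vq; rewrite -/e; nra.
have sx : star x = x by rewrite starB star1 starM starK.
have h0 : 0 <= 2^-1 :> R by [].
have h1 : 2^-1 < 1 :> R by rewrite invf_lt1// ltr1n.
have [y [yq yE]] := sqrt_exists h0 h1 x2.
have sy := sqrt_star h1 yq yE sx.
pose k := 1 - y; have kk : k * k = star V * V by rewrite (sqrt_sq yE) subKr.
have sk : star k = k by rewrite starB star1 sy.
have [l [kl lk]] := neumann h0 h1 yq.
have sl : star l = l.
  have h : star l * k = 1 by rewrite -{1}sk -starM kl star1.
  by rewrite -[LHS]mulr1 -kl mulrA h mul1r.
have [W [VW WV]] : exists W, V * W = 1 /\ W * V = 1.
  have V2 : nrm (1 - V) <= 2^-1 by move: Vq; rewrite nrm_distC; lra.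
  by have [W] := neumann h0 h1 V2; rewrite subKr; exists W.
exists (V * l); split.
  split; rewrite starM sl.
    by rewrite mulrA -(mulrA l) -kk !mulrA lk mul1r kl.
  (* The product fixes [V] from the left; the right inverse [W] of [V] then cancels [V]. *)
  have h : (V * l * (l * star V)) * V = V.
    by rewrite -!mulrA -kk (mulrA l k) lk mul1r lk mulr1.
  by rewrite -[LHS]mulr1 -VW mulrA h.
move=> a b ab ab'.
have aVV : a * (star V * V) = (star V * V) * a.
  have aV : a * star V = star V * b.
    by have /(congr1 (@star _ _ SA)) := ab'; rewrite !starM !starK.
  by rewrite mulrA aV -mulrA -ab mulrA.
have ax : a * x = x * a by rewrite /x mulrBr mulrBl mulr1 mul1r aVV.
have ay := sqrt_commute h1 yq yE ax.
have ak : a * k = k * a by rewrite /k mulrBr mulrBl mulr1 mul1r ay.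
by rewrite -mulrA -(inverse_commute kl lk ak) mulrA ab mulrA.
Qed.

(** Lipschitz bounds on all of [R] pass to sums and to products of bounded paths by plain estimates,
    with no subspace topology on the unit interval. *)
Definition lipschitz_path (g : R -> T) :=
  exists L : R, 0 <= L /\ forall s t, nrm (g s - g t) <= L * `|s - t|.

Lemma lipschitz_path_cst x : lipschitz_path (fun=> x).
Proof. by exists 0; split=> // s t; rewrite subrr nrm0 mul0r. Qed.

Lemma lipschitz_pathD (g h : R -> T) : lipschitz_path g -> lipschitz_path h ->
  lipschitz_path (fun t => g t + h t).
Proof.
move=> [L [L0 gL]] [M [M0 hM]]; exists (L + M); split; first exact: addr_ge0.
move=> s t; rewrite opprD addrACA (le_trans (nrmD _ _))// mulrDl lerD//.
Qed.

Lemma lipschitz_path_sum n (g : 'I_n -> R -> T) :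
  (forall i, lipschitz_path (g i)) -> lipschitz_path (fun t => \sum_i g i t).
Proof.
elim: n g => [|n IH] g gL.
  rewrite (_ : (fun t => _) = fun=> 0); first exact: lipschitz_path_cst.
  by apply/funext => t; rewrite big_ord0.
rewrite (_ : (fun t => _) = fun t => g ord0 t + \sum_i g (lift ord0 i) t).
  by apply: lipschitz_pathD => //; apply: IH.
by apply/funext => t; rewrite big_ord_recl.
Qed.

Lemma lipschitz_pathM (g h : R -> T) (r s : R) :
  (forall t, nrm (g t) <= r) -> (forall t, nrm (h t) <= s) ->
  lipschitz_path g -> lipschitz_path h -> lipschitz_path (fun t => g t * h t).
Proof.
move=> gr hs [L [L0 gL]] [M [M0 hM]].
have r0 : 0 <= r := le_trans (nrm_ge0 _) (gr 0).
have s0 : 0 <= s := le_trans (nrm_ge0 _) (hs 0).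
exists (r * M + L * s); split; first by rewrite addr_ge0// mulr_ge0.
move=> a b; rewrite (_ : _ - _ = g a * (h a - h b) + (g a - g b) * h b); last first.
  by rewrite mulrBr mulrBl subrKA.
rewrite (le_trans (nrmD _ _))// [leRHS]mulrDl lerD//.
  by rewrite -mulrA nrm_le_mul.
by rewrite mulrAC nrm_le_mul.
Qed.

Lemma lipschitz_path_mull x (g : R -> T) (r : R) : (forall t, nrm (g t) <= r) ->
  lipschitz_path g -> lipschitz_path (fun t => x * g t).
Proof.
move=> gr gL; apply: (lipschitz_pathM (g := fun=> x) (fun=> lexx (nrm x)) gr) => //.
exact: lipschitz_path_cst.
Qed.

Lemma lipschitz_path_mulr x (g : R -> T) (r : R) : (forall t, nrm (g t) <= r) ->
  lipschitz_path g -> lipschitz_path (fun t => g t * x).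
Proof.
move=> gr gL; apply: (lipschitz_pathM (h := fun=> x) gr (fun=> lexx (nrm x))) => //.
exact: lipschitz_path_cst.
Qed.

Lemma unitary_commute_star u z : unitary u -> z * u = u * z ->
  z * star u = star u * z.
Proof.
by move=> [u1 u2] zu; apply: (inverse_commute u2 u1).
Qed.

(** Truncating the parameter extends a path from the unit interval to [R] while keeping its
    Lipschitz constant and its norm bounds. *)
Let clamp t : R := Num.min 1 (Num.max 0 t).

Lemma clamp_itv t : 0 <= clamp t <= 1.
Proof. by rewrite /clamp le_min ler01 le_max lexx ge_min lexx. Qed.

Lemma clamp_dist s t : `|clamp s - clamp t| <= `|s - t|.
Proof.
have := ler_norm (s - t); have := ler_norm (t - s); rewrite distrC /clamp ler_norml.
by case: (leP 0 s) => ?; case: (leP 0 t) => ?; do 2?case: (leP 1 _) => ?;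
  move=> *; apply/andP; split; lra.
Qed.

Let half : R[i] := (2^-1 : R)%:C%C.

Lemma half_double z : half *: (z + z) = z.
Proof.
rewrite scalerDr -scalerDl -rmorphD /=.
have -> : (2^-1 + 2^-1 : R) = 1 by field.
by rewrite rmorph1 scale1r.
Qed.

Lemma halves z : half *: z + half *: z = z.
Proof. by rewrite -scalerDr half_double. Qed.

Lemma nrm_half z : nrm (half *: z) = 2^-1 * nrm z.
Proof. by rewrite nrmZr ger0_norm. Qed.

Lemma nrm_halfD x y (q : R) : nrm x <= q -> nrm y <= q ->
  nrm (half *: (x + y)) <= q.
Proof. by move=> xq yq; rewrite nrm_half; have := nrmD x y; lra. Qed.

(* With [j] the skew-adjoint part of [w], the path is
   [t |-> sqrt (1 + t^2 j^2) + t j]; uniqueness of the square root near [1]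
   identifies its value at [t = 1] with [w]. *)
Lemma unitary_path_near1 w : unitary w -> nrm (w - 1) < 1 ->
  exists g : R -> T, [/\ lipschitz_path g, forall t, unitary (g t), g 0 = 1, g 1 = w &
    forall z, z * w = w * z -> forall t, z * g t = g t * z].
Proof.
move=> uw; set q := nrm (w - 1) => q1; have q0 : 0 <= q := nrm_ge0 _.
have qs : nrm (star (w - 1)) = q by rewrite nrm_star.
pose j := half *: (w - star w); pose c := half *: (w + star w).
have sj : star j = - j by rewrite starZr starB starK -scalerN opprB.
have sc : star c = c by rewrite starZr starD starK addrC.
have wE : c + j = w by rewrite -scalerDr addrACA subrr addr0 scalerDr halves.
have swE : c - j = star w by rewrite -sj -{1}sc -starD wE.
(* The unit cancels in the skew-adjoint part, so [j] is half of [(w - 1) - star (w - 1)]. *)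
have jq : nrm j <= q.
  have -> : j = half *: ((w - 1) + (- star (w - 1))).
    by rewrite starB star1 opprB addrA subrK.
  by apply: nrm_halfD => //; rewrite nrmN qs.
have zj z : z * w = w * z -> z * j = j * z.
  move=> zw; rewrite scale_mulr scale_mull; congr (_ *: _).
  by rewrite mulrBr mulrBl zw unitary_commute_star.
pose x t : T := - ((clamp t ^+ 2)%:C%C *: (j * j)).
have jj : nrm (j * j) <= q.
  by have := nrm_le_mul jq jq; have : q * q <= q; [rewrite ler_piMl// ltW|lra].
have xq t : nrm (x t) <= q.
  rewrite nrmN nrmZr normrX ger0_norm; last by have /andP[] := clamp_itv t.
  rewrite -[leRHS]mul1r ler_pM ?exprn_ge0 ?nrm_ge0//.
    by have /andP[] := clamp_itv t.
  by have /andP[? ?] := clamp_itv t; rewrite expr_le1.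
have /choice[y yP] : forall t, exists y, nrm y <= q /\ y + y = x t + y * y.
  by move=> t; exact: sqrt_exists.
have sx t : star (x t) = x t by rewrite starN starZr starM sj mulrNN.
have sy t : star (y t) = y t.
  by have [yq yE] := yP t; exact: (sqrt_star q1 yq yE (sx t)).
have zy z : z * j = j * z -> forall t, z * y t = y t * z.
  move=> h t; have [yq yE] := yP t; apply: (sqrt_commute q1 yq yE).
  have zjj : z * (j * j) = (j * j) * z by rewrite mulrA h -(mulrA j z) h mulrA.
  by rewrite /x mulrN mulNr scale_mulr zjj (scale_mull (clamp t ^+ 2)%:C%C).
have jy := zy j erefl.
have clamp0 : clamp 0 = 0 by rewrite /clamp maxxx min_r.
have clamp1 : clamp 1 = 1 by rewrite /clamp max_r// minxx.
pose g t : T := (1 - y t) + (clamp t)%:C%C *: j.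
have sg t : star (g t) = (1 - y t) - (clamp t)%:C%C *: j.
  by rewrite starD starB star1 sy starZr sj scalerN.
have gg t : (1 - y t) * (1 - y t) -
    ((clamp t)%:C%C *: j) * ((clamp t)%:C%C *: j) = 1.
  have [yq yE] := yP t; rewrite (sqrt_sq yE) scale_mulr scale_mull scalerA.
  by rewrite -rmorphM -expr2 /x opprK addrK.
have jyt t : ((clamp t)%:C%C *: j) * (1 - y t) = (1 - y t) * ((clamp t)%:C%C *: j).
  by rewrite scale_mulr scale_mull mulrBr mulrBl mulr1 mul1r jy.
exists g; split.
- have iq : 0 <= (1 - q)^-1 by rewrite invr_ge0 subr_ge0 ltW.
  (* The term 1 comes from the summand linear in [j], as [nrm j <= q < 1]. The other comes from
     [sqrt_lipschitz]: its factor 2 cancels the 2 in the bound of the difference of squares by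
     [2 * |s - t|]. *)
  exists ((1 - q)^-1 + 1); split; first by rewrite addr_ge0.
  move=> s t; rewrite /g.
  have -> : 1 - y s + (clamp s)%:C%C *: j - (1 - y t + (clamp t)%:C%C *: j) =
      (y t - y s) + ((clamp s - clamp t)%:C%C *: j).
    rewrite opprD addrACA rmorphB scalerBl; congr (_ + _).
    by rewrite opprB addrC subrKA.
  rewrite (le_trans (nrmD _ _))// mulrDl mul1r lerD//; last first.
    rewrite nrmZr -[leRHS]mulr1 ler_pM ?nrm_ge0 ?clamp_dist//.
    exact: le_trans (ltW q1).
  have [ytq ytE] := yP t; have [ysq ysE] := yP s.
  have := sqrt_lipschitz ytq ysq ytE ysE.
  have -> : x t - x s = (clamp s ^+ 2 - clamp t ^+ 2)%:C%C *: (j * j).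
    by rewrite /x opprK addrC rmorphB scalerBl.
  rewrite nrmZr => h; rewrite mulrC ler_pdivlMr ?subr_gt0//.
  have : `|clamp s ^+ 2 - clamp t ^+ 2| <= 2 * `|s - t|.
    rewrite subr_sqr normrM mulrC ler_pM//; last exact: clamp_dist.
    have /andP[? ?] := clamp_itv s; have /andP[? ?] := clamp_itv t.
    by rewrite ger0_norm; lra.
  have := normr_ge0 (clamp s ^+ 2 - clamp t ^+ 2); have := nrm_ge0 (j * j).
  nra.
- move=> t; split; rewrite sg.
    by rewrite (proj1 (diff_squares_comm (jyt t))) gg.
  by rewrite (proj2 (diff_squares_comm (jyt t))) gg.
- have [yq yE] := yP 0; rewrite /g clamp0 scale0r addr0.
  have -> : y 0 = 0; last by rewrite subr0.
  apply: (sqrt_unique q1 yq _ yE); rewrite ?nrm0//.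
  by rewrite /x clamp0 expr0n scale0r oppr0 mul0r.
- have [yq yE] := yP 1; rewrite /g clamp1 scale1r -[RHS]wE; congr (_ + _).
  rewrite -[RHS](subKr 1); congr (_ - _).
  (* Both [y 1] and [1 - c] are roots for [x 1] of norm at most [q], since unitarity of [w] gives
     [c * c = 1 + j * j]; hence [1 - y 1 = c]. *)
  have c1 : 1 - c = half *: ((1 - w) + star (1 - w)).
    by rewrite starB star1 addrACA -opprD scalerBr half_double.
  apply: (sqrt_unique q1 yq _ yE).
    by rewrite c1 nrm_halfD// ?nrm_star nrm_distC.
  have h : c * c - j * j = 1.
    have cj : c * j = j * c.
      by apply: zj; rewrite /c scale_mull scale_mulr mulrDl mulrDr (proj1 uw) (proj2 uw).
    by rewrite -(proj1 (diff_squares_comm (esym cj))) wE swE (proj1 uw).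
  have cc : c * c = 1 + j * j by rewrite -h subrK.
  rewrite /x clamp1 expr1n rmorph1 scale1r mulrBl mul1r mulrBr mulr1 cc.
  by rewrite opprB [RHS]addrCA (addrC 1 (j * j)) -(addrA (j * j)) addKr.
- move=> z zw t; rewrite /g mulrDr mulrDl mulrBr mulrBl mulr1 mul1r (zy z (zj z zw)).
  by rewrite scale_mulr scale_mull zj.
Qed.

End Unitaries.

(** * Homomorphisms and corners *)

Section Homomorphisms.
Variables (R : realType) (A B : completeNormedModType R[i]).
Variables (SA : cstar_structure A) (SB : cstar_structure B).

Record star_hom (f : calg SA -> calg SB) : Prop := StarHom {
  star_homD : forall x y, f (x + y) = f x + f y;
  star_homZ : forall a x, f (a *: x) = a *: f x;
  star_homM : forall x y, f (x * y) = f x * f y;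
  star_hom_star : forall x, f (star x) = star (f x);
  star_hom1 : f 1 = 1 }.

Lemma unital_star_homP (f : calg SA -> calg SB) :
  unital_star_hom SA SB f <-> star_hom f.
Proof.
split; first by move=> [h1 [h2 [h3 [h4 h5]]]]; split.
by move=> [h1 h2 h3 h4 h5]; do !split.
Qed.

Variables (f : calg SA -> calg SB) (hf : star_hom f).

Lemma star_hom0 : f 0 = 0.
Proof. by rewrite -(scale0r (0 : calg SA)) (star_homZ hf) scale0r. Qed.

Lemma star_homN x : f (- x) = - f x.
Proof. by rewrite -scaleN1r (star_homZ hf) scaleN1r. Qed.

Lemma star_homB x y : f (x - y) = f x - f y.
Proof. by rewrite (star_homD hf) star_homN. Qed.

Lemma star_hom_sum I (s : seq I) (P : pred I) (F : I -> calg SA) :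
  f (\sum_(i <- s | P i) F i) = \sum_(i <- s | P i) f (F i).
Proof. exact: (big_morph f (star_homD hf) star_hom0). Qed.

Lemma star_hom_unitary u : unitary u -> unitary (f u).
Proof.
by case=> u1 u2; split; rewrite -(star_hom_star hf) -(star_homM hf) ?u1 ?u2 (star_hom1 hf).
Qed.

(* A self-adjoint [h] of norm less than one is the real part of the unitary
   [h + i sqrt (1 - h^2)]. *)
Lemma star_hom_contractive a : nrm (f a) <= nrm a.
Proof.
have ball1 (h : calg SA) : star h = h -> nrm h < 1 -> nrm (f h) <= 1.
  move=> sh h1; have h0 := nrm_ge0 h.
  have xq : nrm (h * h) <= nrm h.
    by rewrite (le_trans (nrmM _ _))// ler_piMl// ltW.
  have [y [yq yE]] := sqrt_exists h0 h1 xq.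
  have sx : star (h * h) = h * h by rewrite starM sh.
  have sy := sqrt_star h1 yq yE sx.
  have hy : h * y = y * h by apply: (sqrt_commute h1 yq yE); rewrite mulrA.
  pose k := 1 - y; have kk : k * k = 1 - h * h by rewrite (sqrt_sq yE).
  have hk : h * k = k * h by rewrite /k mulrBr mulrBl mulr1 mul1r hy.
  have sk : star k = k by rewrite starB star1 sy.
  pose u : calg SA := h + 'i%C *: k.
  have su : star u = h - 'i%C *: k by rewrite starD sh starZi sk.
  have ik : ('i%C *: k) * h = h * ('i%C *: k).
    by rewrite scale_mulr scale_mull hk.
  have ikk : ('i%C *: k) * ('i%C *: k) = - (k * k).
    by rewrite scale_mulr scale_mull scalerA -expr2 sqr_i scaleN1r.
  have uu : unitary u.
    have [e1 e2] := diff_squares_comm ik.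
    by split; rewrite su ?e1 ?e2 ikk opprK kk addrC subrK.
  have hE : h + h = u + star u by rewrite su addrACA subrr addr0.
  have fu := nrm_unitary_le1 (star_hom_unitary uu).
  have fsu := nrm_unitary_le1 (star_hom_unitary (unitary_star uu)).
  have := nrm_double (f h); rewrite -(star_homD hf) hE (star_homD hf).
  by have := nrmD (f u) (f (star u)); lra.
(* Dividing by [nrm h + e] moves [h] into the open unit ball; then [e] tends to 0. *)
have sa (h : calg SA) : star h = h -> nrm (f h) <= nrm h.
  move=> sh; apply/ler_addgt0Pr => e e0.
  have r0 : 0 < nrm h + e by rewrite ltr_wpDl ?nrm_ge0.
  pose c : R[i] := ((nrm h + e)^-1)%:C%C.
  have nc (D : completeNormedModType R[i]) (z : D) :
      nrm (c *: z) = (nrm h + e)^-1 * nrm z.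
    by rewrite nrmZr gtr0_norm// invr_gt0.
  have := @ball1 (c *: h); rewrite starZr sh => /(_ erefl).
  rewrite (star_homZ hf) !nc !(mulrC (nrm h + e)^-1).
  rewrite ltr_pdivrMr// ler_pdivrMr// !mul1r; apply.
  by rewrite ltrDl.
(* The C*-identity reduces the general case to the self-adjoint element [star a * a]. *)
rewrite -(ler_pXn2r (n := 2)) ?nnegrE ?nrm_ge0// -!nrm_starM -(star_hom_star hf) -(star_homM hf).
by apply: sa; rewrite starM starK.
Qed.

End Homomorphisms.

(** * Paths of unitaries in corners *)

Section CornerPaths.
Variables (R : realType).

Lemma nbhs_nrmP (A : completeNormedModType R[i]) (v : A) (C : set A) :
  nbhs v C <-> exists e : R, 0 < e /\ forall z, nrm (v - z) < e -> C z.
Proof.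
split.
  move=> /nbhs_ballP[e e0 h].
  have eE : e = (complex.Re e)%:C%C by rewrite RRe_real// gtr0_real.
  exists (complex.Re e); split; first by rewrite -ltcR -eE.
  by move=> z vz; apply: h; rewrite -ball_normE /ball_/= normE eE ltcR.
move=> [e [e0 h]]; apply/nbhs_ballP; exists (e%:C%C); first by rewrite /= ltcR.
move=> z; rewrite -ball_normE /ball_/= normE ltcR; exact: h.
Qed.

Variables (A : completeNormedModType R[i]) (SA : cstar_structure A).
Local Notation T := (calg SA).

Definition corner_unitary (P u : T) :=
  u = P * u * P /\ star u * u = P /\ u * star u = P.

Lemma corner_mull P u : P * P = P -> corner_unitary P u -> P * u = u.
Proof. by move=> PP [uE _]; rewrite uE !mulrA PP. Qed.

Lemma corner_mulr P u : P * P = P -> corner_unitary P u -> u * P = u.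
Proof. by move=> PP [uE _]; rewrite uE -!mulrA PP. Qed.

Definition corner_path P (g : R -> T) u :=
  [/\ lipschitz_path g, forall t, corner_unitary P (g t), g 0 = P & g 1 = u].

(** The unitary [w = star u * v + (1 - P)] commutes with [P] and is within distance 1 of the unit,
    as [w - 1 = star u * (v - u)]. Its short path [h] from 1 also commutes with [P], so the
    pointwise product of [g] and [h] stays in the corner and ends at [u * w = v]. *)
Lemma corner_path_step P g u v : projection P ->
  corner_path P g u -> corner_unitary P v -> nrm (v - u) < 1 ->
  exists h, corner_path P h v.
Proof.
move=> [PP sP] [gL gP g0 g1] vP vu.
have uP : corner_unitary P u by rewrite -g1.
have [_ [uu uu']] := uP; have [_ [vv vv']] := vP.
have lP (z : T) : corner_unitary P z -> P * star z = star z /\ star z * P = star z.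
  move=> zP; split.
    by rewrite -{1}sP -starM (corner_mulr PP zP).
  by rewrite -{1}sP -starM (corner_mull PP zP).
have [Psu suP] := lP _ uP; have [Psv svP] := lP _ vP.
have Pu := corner_mull PP uP; have Pv := corner_mull PP vP.
have uP' := corner_mulr PP uP; have vP' := corner_mulr PP vP.
pose w := star u * v + (1 - P).
have PQ : P * (1 - P) = 0 by rewrite mulrBr mulr1 PP subrr.
have QP : (1 - P) * P = 0 by rewrite mulrBl mul1r PP subrr.
have QQ : (1 - P) * (1 - P) = 1 - P by rewrite mulrBr QP subr0 mulr1.
have sQ : star (1 - P) = 1 - P by rewrite starB star1 sP.
have Pw : P * w = star u * v by rewrite mulrDr mulrA Psu PQ addr0.
have wP : w * P = star u * v by rewrite mulrDl -mulrA vP' QP addr0.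
have Qw : (1 - P) * w = 1 - P by rewrite mulrBl mul1r Pw addrC addKr.
have wQ : w * (1 - P) = 1 - P by rewrite mulrBr mulr1 wP addrC addKr.
have sw : star w = star v * u + (1 - P) by rewrite starD starM starK sQ.
have uw : unitary w.
  split.
    rewrite sw mulrDl Qw -(mulrA (star v)) -{1}uP' -(mulrA u) Pw (mulrA u) uu'.
    by rewrite Pv vv addrC subrK.
  rewrite sw mulrDr wQ mulrA -{1}Psv (mulrA w) wP -(mulrA (star u)) vv' suP.
  by rewrite uu addrC subrK.
have w1 : nrm (w - 1) < 1.
  have -> : w - 1 = star u * (v - u).
    by rewrite mulrBr uu /w -addrA (addrAC 1) subrr sub0r.
  rewrite (le_lt_trans (nrmM _ _))// (le_lt_trans _ vu)//.
  rewrite -[leRHS]mul1r ler_wpM2r ?nrm_ge0// nrm_star.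
  exact: (nrm_isometry_le1 _ uu).
have [h [hL hu h0 h1 hz]] := unitary_path_near1 uw w1.
have Ph t : P * h t = h t * P by apply: hz; rewrite Pw wP.
have su1 (t : R) : nrm (g t) <= 1.
  by have [_ [e _]] := gP t; exact: (nrm_isometry_le1 (conj PP sP) e).
exists (fun t => g t * h t); split.
- by apply: (lipschitz_pathM su1 (fun t => nrm_unitary_le1 (hu t))).
- move=> t; have gt := gP t; have [_ [gg gg']] := gt; have [hh hh'] := hu t.
  split; first by rewrite mulrA (corner_mull PP gt) -mulrA -Ph mulrA (corner_mulr PP gt).
  split; rewrite starM.
    by rewrite mulrA -(mulrA (star (h t))) gg -mulrA Ph mulrA hh mul1r.
  by rewrite mulrA -(mulrA (g t)) hh' mulr1.
- by rewrite g0 h0 mulr1.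
- by rewrite g1 h1 -uP' -mulrA Pw mulrA uu' Pv.
Qed.

(** The radius 1 in [corner_path_step] does not depend on the point, so it shows both that the set
    [good] is relatively open and that it is relatively closed. *)
Lemma corner_path_connected P u : projection P ->
  connected (corner_unitary_group SA P) -> corner_unitary P u ->
  exists g, corner_path P g u.
Proof.
move=> PP cP uP; pose good : set A := [set v : T | exists g, corner_path P g v].
have [PPP sP] := PP.
have cuP : corner_unitary P P by split; rewrite ?sP ?PPP.
have : good `&` corner_unitary_group SA P = corner_unitary_group SA P.
  apply: cP.
  - exists (P : A); split; last exact: cuP.
    by exists (fun=> P); split=> //; exact: lipschitz_path_cst.
  - exists [set v : A | exists w : A, good w /\ nrm (v - w) < 1].
      rewrite openE => v [w [gw vw]]; apply/nbhs_nrmP.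
      exists (1 - nrm (v - w)); split; first by rewrite subr_gt0.
      move=> z vz; exists w; split=> //; have := nrm_dist_le v z w.
      by rewrite (nrm_distC z v); lra.
    apply/seteqP; split=> v [].
      by move=> gv vP; split=> //; exists v; rewrite subrr nrm0.
    move=> vP [w [[g gw] vw]]; split=> //.
    exact: (corner_path_step PP gw vP vw).
  - exists (closure good); first exact: closed_closure.
    apply/seteqP; split=> v [].
      by move=> gv vP; split=> //; apply: subset_closure.
    move=> vP clv; split=> //.
    have [|w [[g gw] vw]] := clv [set z | nrm (v - z) < 1].
      by apply/nbhs_nrmP; exists 1.
    exact: (corner_path_step PP gw vP vw).
move=> E; have : corner_unitary_group SA P u := uP.
by rewrite -E => -[].
Qed.

End CornerPaths.

(** * Finite-dimensional subalgebras *)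

Section FiniteDimensional.
Variables (R : realType) (A : completeNormedModType R[i]) (SA : cstar_structure A).
Local Notation T := (calg SA).
Implicit Types (D : set T) (x y z p q v : T).

(** The unit is included because the minimal projections are to sum to 1. The spanning family may be
    linearly dependent. *)
Record fd_subalgebra D : Prop := FdSubalgebra {
  fd_span : exists (N : nat) (s : 'I_N -> T), (forall i, D (s i)) /\
    forall x, D x -> exists c : 'I_N -> R[i], x = \sum_i c i *: s i;
  fd1 : D 1;
  fdD : forall x y, D x -> D y -> D (x + y);
  fdZ : forall a x, D x -> D (a *: x);
  fdM : forall x y, D x -> D y -> D (x * y);
  fd_star : forall x, D x -> D (star x) }.

(** The product of the operators [h - l], for [l] in [rs], applied to [z]. The factored form
    matters: the head of the list is applied last, so removing it from an annihilating list leaves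
    an eigenvector of [h], or 0. *)
Definition mulsub (h : T) (rs : seq R[i]) z :=
  foldr (fun l z => h * z - l *: z) z rs.

Lemma mulsubD h rs y z : mulsub h rs (y + z) = mulsub h rs y + mulsub h rs z.
Proof.
by elim: rs => //= l rs ->; rewrite mulrDr scalerDr opprD addrACA.
Qed.

Lemma mulsubZ h rs a z : mulsub h rs (a *: z) = a *: mulsub h rs z.
Proof.
elim: rs => //= l rs ->; rewrite scale_mulr scalerBr; congr (_ - _).
by rewrite !scalerA mulrC.
Qed.

Lemma mulsub_sum h rs n (F : 'I_n -> T) :
  mulsub h rs (\sum_i F i) = \sum_i mulsub h rs (F i).
Proof.
apply: (big_morph (mulsub h rs) (mulsubD h rs)).
by rewrite -(scale0r (0 : T)) mulsubZ !scale0r.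
Qed.

Lemma mulsubM h rs y z : mulsub h rs y * z = mulsub h rs (y * z).
Proof. by elim: rs => //= l rs <-; rewrite mulrBl scale_mull mulrA. Qed.

Lemma mulsub_eigen h rs l z : h * z = l *: z ->
  mulsub h rs z = (\prod_(m <- rs) (l - m)) *: z.
Proof.
move=> hz; elim: rs => [|m rs IH] /=; first by rewrite big_nil scale1r.
rewrite IH scale_mulr hz big_cons mulrC -scalerA [in RHS]scalerBl scalerBr.
by congr (_ - _); rewrite !scalerA mulrC.
Qed.

Lemma mulsub_commute h rs z w : w * h = h * w -> w * z = z * w ->
  w * mulsub h rs z = mulsub h rs z * w.
Proof.
move=> wh wz; elim: rs => //= l rs IH.
rewrite mulrBr mulrBl scale_mulr scale_mull -IH; congr (_ - _).
by rewrite mulrA wh -mulrA IH mulrA.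
Qed.

Lemma mulsub_mem D h rs z : fd_subalgebra D -> D h -> D z -> D (mulsub h rs z).
Proof.
move=> fD Dh Dz; elim: rs => //= l rs IH.
rewrite -scaleNr; apply: fdD => //; [exact: fdM|exact: fdZ].
Qed.

(* Cayley-Hamilton for left multiplication by [h] on [D]. *)
Lemma mulsub_annihilate D h : fd_subalgebra D -> D h ->
  exists rs, forall x, D x -> mulsub h rs x = 0.
Proof.
move=> fD Dh; have [[|n] [s [Ds sp]]] := fd_span fD.
  by exists [::] => x /sp[c ->] /=; rewrite big_ord0.
have /choice[M hM] : forall i, exists c : 'I_n.+1 -> R[i],
    h * s i = \sum_j c j *: s j by move=> i; apply: sp; exact: fdM.
(* As the [s i] may be dependent, [m] is just one choice of coefficients; by [key], polynomials
   vanishing at [m] still annihilate every [s i]. *)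
pose m : 'M[R[i]]_n.+1 := \matrix_(i, j) M i j.
have [rs] := closed_field_poly_normal (char_poly m).
rewrite (monicP (char_poly_monic m)) scale1r => rsE.
have key (ls : seq R[i]) i : mulsub h ls (s i) =
    \sum_j (horner_mx m (\prod_(l <- ls) ('X - l%:P))) i j *: s j.
  elim: ls i => [|l ls IH] i /=.
    rewrite big_nil rmorph1 (bigD1 i)//= mxE eqxx scale1r big1 ?addr0// => j ji.
    by rewrite mxE eq_sym (negbTE ji) scale0r.
  rewrite IH big_cons mulrC rmorphM rmorphB /= horner_mx_X horner_mx_C.
  set Q := horner_mx m _; rewrite mulr_sumr scaler_sumr.
  have -> : \sum_j h * (Q i j *: s j) = \sum_j \sum_k (Q i j * M j k) *: s k.
    apply: eq_bigr => j _; rewrite scale_mulr hM scaler_sumr.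
    by apply: eq_bigr => k _; rewrite scalerA.
  rewrite exchange_big /= -sumrB; apply: eq_bigr => k _.
  rewrite mulrBr mxE [X in (_ + X) *: _]mxE scalerBl; congr (_ - _).
    rewrite -[Q * m]/(Q *m m) mxE scaler_suml; apply: eq_bigr => j _.
    by rewrite mxE.
  rewrite -[Q * _]/(Q *m _) scalar_mxC mul_scalar_mx mxE.
  by rewrite scalerA.
exists rs => x /sp[c ->]; rewrite mulsub_sum big1 // => i _.
rewrite mulsubZ key -rsE Cayley_Hamilton big1 ?scaler0// => j _.
by rewrite mxE scale0r.
Qed.

(** By normality the self-adjoint element [star g * g] has square [star g * star g * (g * g) = 0];
    the C*-identity is used twice. *)
Lemma normal_sq_eq0 (g : T) : g * star g = star g * g -> g * g = 0 -> g = 0.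
Proof.
move=> gn gg; apply: star_mul_eq0; apply: star_mul_eq0.
by rewrite starM starK !mulrA -(mulrA (star g) g) gn !mulrA -mulrA gg mulr0.
Qed.

(** The C*-identity applied to [e - star e * e] shows that [e] equals the self-adjoint element
    [star e * e]. *)
Lemma normal_idempotent_star (e : T) : e * star e = star e * e -> e * e = e ->
  star e = e.
Proof.
move=> en ee; have se : star e * star e = star e by rewrite -starM ee.
have t1 : star e * (star e * e) = star e * e by rewrite mulrA se.
have t2 : star e * e * e = star e * e by rewrite -mulrA ee.
have t3 : star e * e * (star e * e) = star e * e.
  by rewrite mulrA -(mulrA (star e) e) en mulrA se t2.
have eE : e = star e * e.
  apply/eqP; rewrite -subr_eq0; apply/eqP/star_mul_eq0.
  by rewrite starB starM starK mulrBr !mulrBl t1 t2 t3 !subrr.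
by rewrite {1}eE starM starK -eE.
Qed.

(** For a nonzero projection [p] of [D], this is minimality of [p] in [D]. *)
Definition corner_scalar D p := forall x, D x -> exists c, p * x * p = c *: p.

(** A non-scalar [z = p * x * p] is half of [a - i b] with [a] and [b] self-adjoint, so [a] and [b]
    cannot both be scalar. *)
Lemma selfadjoint_nonscalar D p : fd_subalgebra D -> projection p -> D p ->
  ~ corner_scalar D p ->
  exists h, [/\ D h, star h = h, p * h = h, h * p = h & forall c, h <> c *: p].
Proof.
move=> fD [pp sp] Dp /existsNP[x /not_implyP[Dx /forallNP nx]].
pose z := p * x * p; have Dz : D z by apply: fdM => //; exact: fdM.
have pz : p * z = z by rewrite /z !mulrA pp.
have zp : z * p = z by rewrite /z -mulrA pp.
have psz : p * star z = star z by rewrite -{1}sp -starM zp.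
have szp : star z * p = star z by rewrite -{1}sp -starM pz.
pose a := z + star z; pose b := 'i%C *: (z - star z).
have [[c ac]|/forallNP na] := pselect (exists c, a = c *: p); last first.
  exists a; split => //.
  - by apply: fdD => //; exact: fd_star.
  - by rewrite starD starK addrC.
  - by rewrite mulrDr pz psz.
  - by rewrite mulrDl zp szp.
have [[d bd]|/forallNP nb] := pselect (exists c, b = c *: p); last first.
  exists b; split => //.
  - apply: fdZ => //; rewrite -scaleN1r; apply: fdD => //; apply: fdZ => //.
    exact: fd_star.
  - by rewrite starZi starB starK -scalerN opprB.
  - by rewrite scale_mulr mulrBr pz psz.
  - by rewrite scale_mull mulrBl zp szp.
exfalso; apply: (nx ((2^-1 : R)%:C%C * (c - 'i%C * d))).
rewrite -/z -scalerA scalerBl -scalerA -ac -bd /b scalerA -expr2 sqr_i scaleN1r opprK.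
by rewrite /a addrACA subrr addr0 half_double.
Qed.

(** A spectral projection of a non-scalar self-adjoint [h]. Take a shortest list annihilating [p]
    and drop its head [l]: the resulting [g] is nonzero, normal, and satisfies [h * g = l *: g], so
    [g * g] is a multiple [mu] of [g]. Normality excludes [mu = 0], and [g] divided by [mu] is the
    projection. *)
Lemma split_projection D p : fd_subalgebra D -> projection p -> D p ->
  ~ corner_scalar D p ->
  exists q, [/\ D q, projection q, q <> 0, q <> p & p * q = q /\ q * p = q].
Proof.
move=> fD [pp sp] Dp np.
have [h [Dh sh ph hp nh]] := selfadjoint_nonscalar fD (conj pp sp) Dp np.
have : exists n, `[< exists rs, size rs = n /\ mulsub h rs p = 0 >].
  have [rs hrs] := mulsub_annihilate fD Dh.
  by exists (size rs); apply/asboolP; exists rs; split=> //; exact: hrs.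
move=> /ex_minnP[n /asboolP[[|l rs] [/= sz hrs]] nmin].
  by exfalso; apply: (nh 0); rewrite -ph hrs mul0r scale0r.
pose g := mulsub h rs p.
have g0 : g <> 0.
  move=> g0; have /nmin : `[< exists rs, size rs = n.-1 /\ mulsub h rs p = 0 >].
    by apply/asboolP; exists rs; rewrite -sz.
  by rewrite -sz /= ltnn.
have hg : h * g = l *: g by apply/eqP; rewrite -subr_eq0; apply/eqP.
have Dg : D g by exact: mulsub_mem.
have ghc : g * h = h * g by rewrite [RHS]mulsub_commute// hp ph.
have gpc : g * p = p * g by rewrite [RHS]mulsub_commute// hp ph.
have pg : p * g = g by rewrite -gpc mulsubM pp.
have gn : g * star g = star g * g.
  rewrite [RHS]mulsub_commute//.
    by rewrite -{1}sh -starM -ghc starM sh.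
  by rewrite -{1}sp -starM -gpc starM sp.
have gg : g * g = (\prod_(m <- rs) (l - m)) *: g.
  by rewrite {1}/g mulsubM pg (mulsub_eigen _ hg).
set mu := \prod_(m <- rs) (l - m) in gg.
have mu0 : mu != 0.
  by apply/eqP => mu0; apply: g0; apply: normal_sq_eq0 => //; rewrite gg mu0 scale0r.
pose e := mu^-1 *: g.
have ee : e * e = e by rewrite scale_mull scale_mulr gg (scalerA _ mu) mulVf// scale1r.
have en : e * star e = star e * e.
  by rewrite /e starZ !scale_mull !scale_mulr gn !scalerA mulrC.
exists e; split.
- exact: fdZ.
- by split=> //; exact: normal_idempotent_star.
- by move/eqP; rewrite scaler_eq0 invr_eq0 (negbTE mu0) => /eqP.
(* If [e = p], then [h = h * e = l *: p], against the choice of [h]. *)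
- by move=> ep; apply: (nh l); rewrite -hp -ep scale_mulr hg scalerA mulrC -scalerA.
- by split; rewrite (scale_mulr, scale_mull) ?gpc pg.
Qed.

Definition orthogonal_family D n (p : 'I_n -> T) :=
  [/\ forall i, D (p i), forall i, projection (p i), forall i, p i <> 0,
    forall i j, i != j -> p i * p j = 0 & \sum_i p i = 1].

(** Nonzero orthogonal projections are linearly independent: multiplying a relation by [p k]
    isolates its [k]-th coefficient. So their coordinate matrix has full row rank. *)
Lemma orthogonal_family_bound D N (s : 'I_N -> T) n (p : 'I_n -> T) :
  (forall x, D x -> exists c : 'I_N -> R[i], x = \sum_i c i *: s i) ->
  orthogonal_family D p -> (n <= N)%N.
Proof.
move=> sp [Dp pp p0 po _].
have /choice[c cE] : forall i, exists c : 'I_N -> R[i], p i = \sum_j c j *: s j.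
  by move=> i; exact: sp.
pose M : 'M[R[i]]_(n, N) := \matrix_(i, j) c i j.
have rf : row_free M.
  apply: inj_row_free => u uM; apply/rowP => k; rewrite mxE.
  have up : \sum_i u 0 i *: p i = 0.
    under eq_bigr do rewrite cE scaler_sumr.
    rewrite exchange_big /= big1 // => j _.
    have := congr1 (fun m : 'rV_N => m 0 j) uM; rewrite !mxE => uj.
    rewrite -[RHS](scale0r (s j)) -uj scaler_suml; apply: eq_bigr => i _.
    by rewrite scalerA mxE.
  have := congr1 (fun z => z * p k) up; rewrite mul0r mulr_suml (bigD1 k)//=.
  rewrite big1 ?addr0 => [|i ik]; last by rewrite scale_mull po// scaler0.
  by rewrite scale_mull (proj1 (pp k)) => /eqP; rewrite scaler_eq0 => /orP[/eqP|/eqP/p0].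
by rewrite -(eqP rf) rank_leq_col.
Qed.

(** The projection [p i] gives way to [p i - q], and [q] enters at index [ord0], which leaves the
    sum unchanged. *)
Lemma orthogonal_family_split D n (p : 'I_n -> T) i q : fd_subalgebra D ->
  orthogonal_family D p -> D q -> projection q -> q <> 0 -> q <> p i ->
  p i * q = q -> q * p i = q -> exists p' : 'I_n.+1 -> T, orthogonal_family D p'.
Proof.
move=> fD [Dp pp p0 po p1] Dq [qq sq] q0 qp pq qp'.
have [pipi spi] := pp i.
pose f k := if k == i then p i - q else p k.
exists (fun j => if unlift ord0 j is Some k then f k else q).
have qf k : q * f k = 0 /\ f k * q = 0.
  rewrite /f; case: eqVneq => [_|ki].
    by rewrite mulrBr mulrBl qq pq qp' subrr.
  split; first by rewrite -qp' -mulrA po ?mulr0// eq_sym.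
  by rewrite -pq mulrA po// mul0r.
split.
- move=> j; case: (unliftP ord0 j) => // k _; rewrite /f; case: eqP => // _.
  by rewrite -scaleN1r; apply: fdD => //; exact: fdZ.
- move=> j; case: (unliftP ord0 j) => // k _; rewrite /f; case: eqP => // _.
  split; last by rewrite starB spi sq.
  by rewrite mulrBr !mulrBl pipi qp' pq qq subrr subr0.
- move=> j; case: (unliftP ord0 j) => // k _; rewrite /f; case: eqP => // _.
  by move/eqP; rewrite subr_eq0 => /eqP/esym.
- move=> j j'; case: (unliftP ord0 j) => [k|] ->; case: (unliftP ord0 j') => [k'|] -> //.
  + move=> /= jj; have {jj} kk : k != k' by apply: contraNneq jj => ->.
    rewrite /f; case: eqVneq => [ki|ki]; case: eqVneq => [k'i|k'i].
    * by rewrite ki k'i eqxx in kk.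
    * by rewrite mulrBl -{1}qp' -(mulrA q) (po i k') 1?eq_sym// mulr0 subrr.
    * by rewrite mulrBr -{1}pq mulrA (po k i)// mul0r subrr.
    * exact: po.
  + by move=> _; exact: (qf k).2.
  + by move=> _; exact: (qf k').1.
- rewrite big_ord_recl unlift_none; under eq_bigr do rewrite liftK.
  rewrite (bigD1 i)//= {1}/f eqxx -p1 [RHS](bigD1 i)//= addrA; congr (_ + _).
    by rewrite addrC subrK.
  by apply: eq_bigr => k ki; rewrite /f (negbTE ki).
Qed.

(** A family of maximal length works: a member that is not minimal could be split, giving a longer
    family. *)
Lemma exists_minimal_family D : fd_subalgebra D ->
  exists n (p : 'I_n -> T), orthogonal_family D p /\
    forall i, corner_scalar D (p i).
Proof.
move=> fD; have [N [s [_ sp]]] := fd_span fD.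
have ex : exists n, `[< exists p : 'I_n -> T, orthogonal_family D p >].
  (* Members must be nonzero, so in the zero algebra only the empty family qualifies. *)
  have [T0|T1] := pselect ((1 : T) = 0).
    exists 0%N; apply/asboolP; exists (fun=> 0); split; try by case.
    by rewrite big_ord0 T0.
  exists 1%N; apply/asboolP; exists (fun=> 1); split=> //.
  - by move=> _; exact: fd1.
  - by move=> _; exact: projection1.
  - by move=> i j; rewrite !ord1.
  - by rewrite big_ord1.
have ub n : `[< exists p : 'I_n -> T, orthogonal_family D p >] -> (n <= N)%N.
  by move=> /asboolP[p]; exact: (orthogonal_family_bound sp).
have [n /asboolP[p op] nmax] := ex_maxnP ex ub.
exists n, p; split=> // i; apply: contrapT => ni.
have [Dp pp p0 po p1] := op.
have [q [Dq qP q0 qp [pq qp']]] := split_projection fD (pp i) (Dp i) ni.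
have [p' op'] := orthogonal_family_split fD op Dq qP q0 qp pq qp'.
have /nmax : `[< exists p : 'I_n.+1 -> T, orthogonal_family D p >].
  by apply/asboolP; exists p'.
by rewrite ltnn.
Qed.

End FiniteDimensional.

(** * Matrix units of a finite-dimensional subalgebra *)

Section MatrixUnits.
Variables (R : realType) (A : completeNormedModType R[i]) (SA : cstar_structure A).
Local Notation T := (calg SA).
Implicit Types (D : set T) (x y z p q v : T).

Lemma isometry_mulr v q : star v * v = q -> projection q -> v * q = v.
Proof.
move=> vv [qq sq]; apply/eqP; rewrite -subr_eq0; apply/eqP/star_mul_eq0.
have e1 : star v * (v * q) = q by rewrite mulrA vv qq.
have e2 : q * star v * (v * q) = q by rewrite -mulrA e1 qq.
have e3 : q * star v * v = q by rewrite -mulrA vv qq.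
by rewrite starB starM sq mulrBr !mulrBl e1 e2 e3 vv !subrr.
Qed.

(* [p y q = y] with [p] and [q] orthogonal: were [star y * y] equal to [- q],
   then [w := p + q + i (y + star y)] would satisfy [star w * w = 0], whereas [p w p = p]. *)
Lemma star_mul_neq_opp p q y : projection p -> projection q -> p * q = 0 ->
  q * p = 0 -> p * y = y -> y * q = y -> star y * y = - q -> y * star y = - p ->
  p = 0.
Proof.
move=> [pp sp] [qq sq] pq qp py yq yy yy'.
have syp : star y * p = star y by rewrite -{1}sp -starM py.
have qsy : q * star y = star y by rewrite -{1}sq -starM yq.
have y2 : y * y = 0 by rewrite -{1}yq -{2}py -mulrA (mulrA q) qp mul0r mulr0.
have sy2 : star y * star y = 0 by rewrite -starM y2 star0.
have yp : y * p = 0 by rewrite -yq -mulrA qp mulr0.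
have qy : q * y = 0 by rewrite -py mulrA qp mul0r.
have psy : p * star y = 0 by rewrite -{1}sp -starM yp star0.
have syq : star y * q = 0 by rewrite -{1}sq -starM qy star0.
pose z := y + star y; pose e := p + q.
have ez : e * z = z.
  by rewrite mulrDl !mulrDr py psy qy qsy addr0 add0r.
have ze : z * e = z.
  by rewrite mulrDl !mulrDr yp yq syp syq addr0 add0r.
have zz : z * z = - e.
  by rewrite mulrDl !mulrDr y2 sy2 yy yy' add0r addr0 opprD.
have ee : e * e = e by rewrite mulrDl !mulrDr pp pq qp qq addr0 add0r.
have sz : star z = z by rewrite starD starK addrC.
have se : star e = e by rewrite starD sp sq.
have w0 : e + 'i%C *: z = 0.
  apply: star_mul_eq0; rewrite starD starZi se sz.
  have c : ('i%C *: z) * e = e * ('i%C *: z) by rewrite scale_mulr scale_mull ez ze.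
  rewrite (proj1 (diff_squares_comm c)) ee scale_mulr scale_mull scalerA.
  by rewrite -expr2 sqr_i scaleN1r zz opprK subrr.
have := congr1 (fun w => p * w * p) w0.
rewrite mulr0 mul0r mulrDr mulrDl scale_mulr scale_mull /e /z !mulrDr.
by rewrite py psy addr0 yp scaler0 addr0 pp pq addr0 pp.
Qed.

(** For [y = p * x * q], minimality makes [star y * y] and [y * star y] scalar in their corners;
    comparing them inside [y * star y * y] shows that the scalar is the same. It is real and
    nonzero, and a positive one is normalised away by its square root. *)
Lemma corner_scalar_isometry D p q x : fd_subalgebra D ->
  projection p -> projection q -> D p -> D q ->
  corner_scalar D p -> corner_scalar D q -> p * q = 0 -> q * p = 0 ->
  D x -> p * x * q <> 0 -> exists v, [/\ D v, v * star v = p & star v * v = q].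
Proof.
move=> fD [pp sp] [qq sq] Dp Dq mp mq pq qp Dx.
set y := p * x * q => y0.
have Dy : D y by apply: fdM => //; exact: fdM.
have py : p * y = y by rewrite /y !mulrA pp.
have yq : y * q = y by rewrite /y -!mulrA qq.
have syp : star y * p = star y by rewrite -{1}sp -starM py.
have qsy : q * star y = star y by rewrite -{1}sq -starM yq.
have [c cE] : exists c, star y * y = c *: q.
  have [|c cE] := mq (star y * y); first by apply: fdM => //; exact: fd_star.
  by exists c; rewrite -cE mulrA qsy -mulrA yq.
have [d dE] : exists d, y * star y = d *: p.
  have [|d dE] := mp (y * star y); first by apply: fdM => //; exact: fd_star.
  by exists d; rewrite -dE mulrA py -mulrA syp.
have q0 : q <> 0 by move=> q0; apply: y0; rewrite -yq q0 mulr0.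
have p0 : p <> 0 by move=> p0; apply: y0; rewrite -py p0 mul0r.
have cd : c = d.
  have : c *: y = d *: y.
    by rewrite -{1}yq -scale_mulr -cE mulrA dE scale_mull py.
  by move/eqP; rewrite -subr_eq0 -scalerBl scaler_eq0 subr_eq0 => /orP[/eqP|/eqP].
have c0 : c <> 0.
  by move=> c0; apply: y0; apply: star_mul_eq0; rewrite cE c0 scale0r.
have cr : (c^*)%C = c.
  have : (c^*)%C *: q = c *: q by rewrite -{1}sq -starZ -cE starM starK.
  by move/eqP; rewrite -subr_eq0 -scalerBl scaler_eq0 subr_eq0 => /orP[/eqP|/eqP].
have [r rE] : exists r : R, c = r%:C%C.
  move: cr; case: (c) => a b [] /eqP.
  by rewrite -subr_eq0 -opprD oppr_eq0 -mulr2n mulrn_eq0 /= => /eqP ->; exists a.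
have scal (s : R) : let u : T := s%:C%C *: y in
    star u * u = (s ^+ 2 * r)%:C%C *: q /\ u * star u = (s ^+ 2 * r)%:C%C *: p.
  by split; rewrite starZr scale_mull scale_mulr ?cE ?dE -?cd rE !scalerA -!rmorphM /= expr2.
have r0 : r != 0 by apply/eqP => r0; apply: c0; rewrite rE r0.
have [rp|rn] := ltrP 0 r.
  have [e1 e2] := scal (Num.sqrt r)^-1.
  exists ((Num.sqrt r)^-1%:C%C *: y); split; first exact: fdZ.
    by rewrite e2 exprVn sqr_sqrtr ?ltW// mulVf// rmorph1 scale1r.
  by rewrite e1 exprVn sqr_sqrtr ?ltW// mulVf// rmorph1 scale1r.
(* A negative scalar, rescaled to -1, is excluded by [star_mul_neq_opp], which takes the place of
   positivity of [star y * y]. *)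
exfalso; have rn' : 0 <= - r by rewrite oppr_ge0.
have [e1 e2] := scal (Num.sqrt (- r))^-1.
have rr : (Num.sqrt (- r))^-1 ^+ 2 * r = -1.
  by rewrite exprVn sqr_sqrtr// invrN mulNr mulVf.
apply: p0; apply: (star_mul_neq_opp (q := q) (y := (Num.sqrt (- r))^-1%:C%C *: y)) => //.
- by rewrite scale_mulr py.
- by rewrite scale_mull yq.
- by rewrite e1 rr rmorphN rmorph1 scaleN1r.
- by rewrite e2 rr rmorphN rmorph1 scaleN1r.
Qed.

(** Each [v i] is a partial isometry whose initial projection is the range projection of [v (r i)].
    The relations mention no subalgebra, so unital *-homomorphisms transport them. *)
Record unit_system n (r : 'I_n -> 'I_n) (v : 'I_n -> T) : Prop := UnitSystem {
  us_starM : forall i, star (v i) * v i = v (r i) * star (v (r i));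
  us_isometry : forall i, v i * star (v i) * v i = v i;
  us_orth : forall i j, i != j -> star (v i) * v j = 0;
  us_sum : \sum_i v i * star (v i) = 1 }.

(* The elements [v i * star (v j)] with [r i = r j] are matrix units of [D],
   the nonempty fibres of [r] being the simple summands. *)
Record matrix_units D n (r : 'I_n -> 'I_n) (v : 'I_n -> T) : Prop := MatrixUnits {
  mu_mem : forall i, D (v i);
  mu_system : unit_system r v;
  mu_span : forall x, D x -> exists c : 'I_n -> 'I_n -> R[i],
    x = \sum_i \sum_(j | r i == r j) c i j *: (v i * star (v j)) }.

(** Minimal projections [p i] and [p j] lie in the same summand exactly when some [p i * x * p j]
    with [x] in [D] is nonzero. The map [r] chooses a representative of each class, and [v i]
    carries [p (r i)] to [p i]. *)
Lemma exists_matrix_units D : fd_subalgebra D ->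
  exists n (r : 'I_n -> 'I_n) (v : 'I_n -> T), matrix_units D r v.
Proof.
move=> fD; have [n [p [[Dp pp p0 po p1] mp]]] := exists_minimal_family fD.
have ppp i : p i * p i = p i := (pp i).1.
have sp i : star (p i) = p i := (pp i).2.
pose e i j : bool := `[< exists x, D x /\ p i * x * p j <> 0 >].
have exx i : e i i.
  by apply/asboolP; exists 1; split; [exact: fd1|rewrite mulr1 ppp].
have esymm i j : e i j -> e j i.
  move=> /asboolP[x [Dx x0]]; apply/asboolP; exists (star x).
  split; first exact: fd_star.
  have E : star (p i * x * p j) = p j * star x * p i by rewrite !starM !sp mulrA.
  by rewrite -E => h; apply: x0; rewrite -[LHS]starK h star0.
have etrans i j k : e i j -> e j k -> e i k.
  move=> /asboolP[x [Dx x0]] /asboolP[y [Dy y0]]; apply/asboolP.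
  (* [star u * u] is a nonzero multiple of [p j], so multiplying by [star u] recovers
     [p j * y * p k] from the product. *)
  pose u := p i * x * p j; have Du : D (star u * u).
    by apply: fdM => //; [apply: fd_star => //|]; do 2![apply: fdM => //].
  have [c cE] := mp j _ Du.
  have uE : star u * u = c *: p j.
    rewrite -cE /u !starM !sp -!mulrA ppp !mulrA.
    by rewrite -(mulrA (p j) (p j)) ?ppp // mulrA ppp.
  have c0 : c != 0.
    by apply/eqP => c0; apply: x0; apply: star_mul_eq0; rewrite -/u uE c0 scale0r.
  exists (x * p j * y); split; first by do 2![apply: fdM => //].
  move=> h; apply: y0.
  have : star u * (p i * (x * p j * y) * p k) = c *: (p j * y * p k).
    rewrite -scale_mull -scale_mull -uE {2}/u -!mulrA.
    by congr (_ * _); rewrite mulrA.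
  by rewrite h mulr0 => /esym/eqP; rewrite scaler_eq0 (negbTE c0) => /eqP.
pose r i := odflt i [pick j | e i j].
have er i : e i (r i).
  by rewrite /r; case: pickP => [j|_] //=; exact: exx.
have rr i j : (r i == r j) = e i j.
  apply/eqP/idP => [ij|ij].
    by apply: (etrans _ (r i)) => //; rewrite ij; apply: esymm.
  have eij k : e i k = e j k.
    by apply/idP/idP; [apply: etrans (esymm _ _ ij)|apply: etrans].
  rewrite /r (eq_pick eij); case: pickP => //= /(_ j).
  by rewrite exx.
have /choice[v vP] : forall i, exists v,
    [/\ D v, v * star v = p i & star v * v = p (r i)].
  (* [corner_scalar_isometry] needs orthogonal projections, so a representative gets its own
     projection. *)
  move=> i; have [ri|ri] := eqVneq i (r i).
    by exists (p i); rewrite -ri sp ppp.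
  have /asboolP[x [Dx x0]] := er i.
  by apply: (corner_scalar_isometry fD _ _ _ _ _ _ _ _ Dx x0) => //; rewrite po// eq_sym.
have Dv i : D (v i) by have [] := vP i.
have vv i : v i * star (v i) = p i by have [] := vP i.
have vv' i : star (v i) * v i = p (r i) by have [] := vP i.
have viso i : v i * star (v i) * v i = v i.
  by rewrite -mulrA vv' (isometry_mulr (vv' i)).
have vpr i : v i * p (r i) = v i by rewrite -vv' mulrA viso.
have pv i : p i * v i = v i by rewrite -vv viso.
have svp i : star (v i) * p i = star (v i) by rewrite -{1}sp -starM pv.
exists n, r, v; split=> //.
  split=> //; first by move=> i; rewrite vv' vv.
    by move=> i j ij; rewrite -svp -(pv j) -mulrA (mulrA (p i)) po// mul0r mulr0.
  by rewrite -[RHS]p1; apply: eq_bigr.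
move=> x Dx.
have /choice[c cE] : forall i, exists c : 'I_n -> R[i], forall j, r i = r j ->
    p i * x * p j = c j *: (v i * star (v j)).
  move=> i; have /choice[c cE] : forall j, exists c : R[i], r i = r j ->
      p i * x * p j = c *: (v i * star (v j)); last by exists c.
  move=> j; have [ij|/eqP nij] := eqVneq (r i) (r j); last by exists 0 => /nij.
  have Dw : D (star (v i) * x * v j).
    by apply: fdM => //; apply: fdM => //; apply: fd_star.
  have [c cE] := mp (r i) _ Dw; exists c => _.
  have psv : p (r i) * star (v j) = star (v j) by rewrite ij -{1}sp -starM vpr.
  have psvi : p (r i) * star (v i) = star (v i) by rewrite -{1}sp -starM vpr.
  have -> : v i * star (v j) = v i * p (r i) * star (v j) by rewrite vpr.
  rewrite -scale_mull -scale_mulr -cE -(vv i) -(vv j) -!mulrA psv.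
  by rewrite (mulrA (p (r i))) psvi.
(* Expand [x] between two copies of the unit; entries between different classes vanish by the
   definition of [e]. *)
exists c; transitivity ((\sum_i p i) * x * (\sum_j p j)); first by rewrite p1 mul1r mulr1.
rewrite mulr_suml mulr_suml; apply: eq_bigr => i _.
rewrite mulr_sumr [RHS]big_mkcond; apply: eq_bigr => j _.
case: eqP => [/cE//|/eqP]; rewrite rr => /negP nij.
by apply: contrapT => h; apply: nij; apply/asboolP; exists x.
Qed.

End MatrixUnits.

(** * Commutants of finite-dimensional images *)

Section UnitSystems.
Variables (R : realType) (A : completeNormedModType R[i]) (SA : cstar_structure A).
Local Notation T := (calg SA).
Variables (n : nat) (r : 'I_n -> 'I_n) (v : 'I_n -> T) (vS : unit_system r v).

Lemma us_projection i : projection (v i * star (v i)).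
Proof.
split; last by rewrite starM starK.
by rewrite mulrA (us_isometry vS).
Qed.

Lemma us_mulp i : v i * (v (r i) * star (v (r i))) = v i.
Proof. by rewrite -(us_starM vS) mulrA (us_isometry vS). Qed.

Lemma us_pmul_star i : v (r i) * star (v (r i)) * star (v i) = star (v i).
Proof. by rewrite -{1}(us_projection _).2 -starM us_mulp. Qed.

Lemma us_nrm_le1 i : nrm (v i) <= 1.
Proof. exact: (nrm_isometry_le1 (us_projection (r i)) (us_starM vS i)). Qed.

Lemma us_nrm_star_le1 i : nrm (star (v i)) <= 1.
Proof. by rewrite nrm_star us_nrm_le1. Qed.

Lemma us_sum_mul (a : 'I_n -> T) i :
  (\sum_j a j * star (v j)) * v i = a i * (v (r i) * star (v (r i))).
Proof.
rewrite mulr_suml (bigD1 i)//= big1 ?addr0.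
  by rewrite -mulrA (us_starM vS).
by move=> j ji; rewrite -mulrA (us_orth vS)// mulr0.
Qed.

Lemma us_mul_sum (a : 'I_n -> T) i :
  star (v i) * (\sum_j v j * a j) = v (r i) * star (v (r i)) * a i.
Proof.
rewrite mulr_sumr (bigD1 i)//= big1 ?addr0.
  by rewrite mulrA (us_starM vS).
by move=> j ji; rewrite mulrA (us_orth vS) ?mul0r// eq_sym.
Qed.

(** The entry [a (r i)] is copied along [v i], the same one throughout a fibre of [r]. For entries
    in the corresponding corners this makes the sum commute with the matrix units. *)
Definition block_diag (a : 'I_n -> T) := \sum_i v i * a (r i) * star (v i).

Lemma block_diag_mul a i : block_diag a * v i = v i * (a (r i) * (v (r i) * star (v (r i)))).
Proof. by rewrite us_sum_mul -!mulrA. Qed.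

Lemma mul_block_diag a i : star (v i) * block_diag a =
  v (r i) * star (v (r i)) * a (r i) * star (v i).
Proof.
rewrite /block_diag; under eq_bigr do rewrite -mulrA.
by rewrite us_mul_sum mulrA.
Qed.

Lemma block_diag_star a : star (block_diag a) = block_diag (fun i => star (a i)).
Proof.
by rewrite star_sum; apply: eq_bigr => i _; rewrite !starM starK mulrA.
Qed.

Lemma block_diagM a b : (forall i, a i * (v i * star (v i)) = a i) ->
  block_diag a * block_diag b = block_diag (fun i => a i * b i).
Proof.
move=> ap; rewrite {2}/block_diag mulr_sumr; apply: eq_bigr => i _.
by rewrite !(mulrA (block_diag a)) block_diag_mul ap !mulrA.
Qed.

Lemma block_diag_id : block_diag (fun i => v i * star (v i)) = 1.
Proof. by rewrite -(us_sum vS); apply: eq_bigr => i _; rewrite us_mulp. Qed.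

End UnitSystems.

Lemma corner_unitary_commute (R : realType) (A : completeNormedModType R[i])
    (SA : cstar_structure A) (P W : calg SA) :
  projection P -> unitary W -> W * P = P * W -> corner_unitary P (W * P).
Proof.
move=> [PP sP] [W1 W2] WP; split; first by rewrite mulrA -WP -!mulrA !PP.
rewrite starM sP; split.
  by rewrite mulrA -(mulrA P) W1 mulr1.
by rewrite mulrA -(mulrA W) PP WP -mulrA W2 mulr1.
Qed.

Section Commutant.
Variables (R : realType) (A B : completeNormedModType R[i]).
Variables (SA : cstar_structure A) (SB : cstar_structure B).
Variables (D : set (calg SA)) (n : nat) (r : 'I_n -> 'I_n) (v : 'I_n -> calg SA).
Hypotheses (fD : fd_subalgebra D) (vD : matrix_units D r v).

Lemma unit_system_hom (f : calg SA -> calg SB) : star_hom f ->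
  unit_system r (f \o v).
Proof.
move=> hf; have [s1 s2 s3 s4] := mu_system vD; split=> /=.
- by move=> i; rewrite -!(star_hom_star hf) -!(star_homM hf) s1.
- by move=> i; rewrite -!(star_hom_star hf) -!(star_homM hf) s2.
- by move=> i j ij; rewrite -!(star_hom_star hf) -!(star_homM hf) s3// star_hom0.
- rewrite -(star_hom1 hf) -s4 (star_hom_sum hf); apply: eq_bigr => i _.
  by rewrite (star_homM hf) (star_hom_star hf).
Qed.

Lemma intertwine_span (f g : calg SA -> calg SB) (V : calg SB) :
  star_hom f -> star_hom g ->
  (forall i j, r i = r j ->
    V * (f (v i) * star (f (v j))) = (g (v i) * star (g (v j))) * V) ->
  forall x, D x -> V * f x = g x * V.
Proof.
move=> hf hg h x /(mu_span vD)[c ->].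
rewrite (star_hom_sum hf) (star_hom_sum hg) mulr_sumr mulr_suml; apply: eq_bigr => i _.
rewrite (star_hom_sum hf) (star_hom_sum hg) mulr_sumr mulr_suml; apply: eq_bigr => j /eqP ij.
rewrite (star_homZ hf) (star_homZ hg) scale_mulr scale_mull; congr (_ *: _).
by rewrite (star_homM hf) (star_homM hg) (star_hom_star hf) (star_hom_star hg) h.
Qed.

(** The sum [V] of the [g (v i) * star (f (v i))] intertwines [f] and [g] exactly on matrix units,
    and is near 1 because it would be 1 if [f] and [g] agreed on the [v i]. Its [n] error terms add
    up to at most [8^-1], the bound of [polar_unitary]; [n.+1] keeps the denominator nonzero. *)
Lemma close_homs_equivalent (f g : calg SA -> calg SB) :
  star_hom f -> star_hom g ->
  (forall i, nrm (g (v i) - f (v i)) <= (8 * n.+1%:R)^-1) ->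
  exists U, unitary U /\ forall x, D x -> U * f x = g x * U.
Proof.
move=> hf hg fg; have uf := unit_system_hom hf; have ug := unit_system_hom hg.
pose V : calg SB := \sum_i g (v i) * star (f (v i)).
have V1 : nrm (V - 1) <= 8^-1.
  rewrite -(us_sum uf) -sumrB (le_trans (nrm_sum _ _ _))//.
  have le i : nrm (g (v i) * star (f (v i)) - f (v i) * star (f (v i))) <= (8 * n.+1%:R)^-1.
    rewrite -mulrBl -[leRHS]mulr1; apply: nrm_le_mul; first exact: fg.
    exact: (us_nrm_star_le1 uf).
  apply: (le_trans (ler_sum _ (fun i _ => le i))).
  rewrite sumr_const card_ord -[_ *+ n]mulr_natr invfM -mulrA ler_piMr ?invr_ge0//.
  by rewrite mulrC ler_pdivrMr ?ltr0n// mul1r ler_nat.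
have VD : forall x, D x -> V * f x = g x * V.
  apply: intertwine_span => // i j ij.
  rewrite mulrA (us_sum_mul uf (g \o v)) /= -mulrA.
  rewrite -[RHS]mulrA (us_mul_sum ug (fun k => star (f (v k)))) /= mulrA.
  have fj : f (v (r j)) * star (f (v (r j))) * star (f (v j)) = star (f (v j)).
    exact: (us_pmul_star uf j).
  have gi : g (v i) * (g (v (r i)) * star (g (v (r i)))) = g (v i).
    exact: (us_mulp ug i).
  by rewrite -mulrA ij fj -ij mulrA gi.
have [U [uU UV]] := polar_unitary V1; exists U; split=> // x Dx.
apply: UV; first exact: VD.
by rewrite -(star_hom_star hf) -(star_hom_star hg) VD//; apply: fd_star.
Qed.

(** HUC joins [p i] to [W * p i] inside each corner, and [block_diag] assembles these paths into one
    in the commutant. *)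
Lemma commutant_unitary_path (f : calg SA -> calg SB) (W : calg SB) :
  HUC SB -> star_hom f -> unitary W ->
  (forall x, D x -> W * f x = f x * W) ->
  exists g : R -> calg SB, [/\ lipschitz_path g, forall t, unitary (g t),
    g 0 = 1, g 1 = W & forall t x, D x -> g t * f x = f x * g t].
Proof.
move=> hucB hf uW Wf; have uf := unit_system_hom hf.
pose V i := f (v i); pose p i := V i * star (V i).
have pp i : projection (p i) := us_projection uf i.
have Wp i : W * p i = p i * W.
  rewrite /p /V -(star_hom_star hf) -(star_homM hf) Wf//.
  by apply: fdM => //; [|apply: fd_star => //]; exact: (mu_mem vD).
have WV i : W * V i = V i * W by apply: Wf; exact: (mu_mem vD).
have Vp i : V i * p (r i) = V i := us_mulp uf i.
have cW i : corner_unitary (p i) (W * p i).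
  exact: corner_unitary_commute.
have /choice[h hP] : forall i, exists g, corner_path (p i) g (W * p i).
  by move=> i; apply: corner_path_connected (cW i) => //; exact: (hucB (p i) (pp i)).
have hL i : lipschitz_path (h i) by have [] := hP i.
have hc i t : corner_unitary (p i) (h i t) by have [_ hc _ _] := hP i; exact: hc.
have h0 i : h i 0 = p i by have [] := hP i.
have h1 i : h i 1 = W * p i by have [] := hP i.
have hp i t : h i t * p i = h i t := corner_mulr (pp i).1 (hc i t).
have ph i t : p i * h i t = h i t := corner_mull (pp i).1 (hc i t).
have hn i t : nrm (h i t) <= 1.
  by have [_ [e _]] := hc i t; exact: (nrm_isometry_le1 (pp i) e).
pose g t := block_diag r V (fun i => h i t).
exists g; split.
- apply: lipschitz_path_sum => i.
  apply: (@lipschitz_path_mulr _ _ _ _ _ (nrm (V i) * 1)).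
    by move=> t; apply: nrm_le_mul.
  exact: lipschitz_path_mull.
- move=> t; have shp i : star (h i t) * p i = star (h i t).
    by rewrite -{1}(pp i).2 -starM ph.
  split; rewrite block_diag_star (block_diagM uf)// -(block_diag_id uf);
    apply: eq_bigr => i _; congr (_ * _ * _); by have [_ []] := hc (r i) t.
- by rewrite -(block_diag_id uf); apply: eq_bigr => i _; rewrite h0.
(* As [W] commutes with every [V i], it is itself the block diagonal element with entries
   [W * p i]. *)
- rewrite -[RHS]mulr1 -(us_sum uf) mulr_sumr; apply: eq_bigr => i _.
  by rewrite h1 (mulrA (V i) W) -WV -(mulrA W) Vp mulrA.
- move=> t; apply: intertwine_span => // i j ij.
  rewrite mulrA (block_diag_mul uf) -[RHS]mulrA (mul_block_diag uf).
  have -> : h (r i) t * (V (r i) * star (V (r i))) = h (r i) t := hp (r i) t.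
  have -> : V (r j) * star (V (r j)) * h (r j) t = h (r j) t := ph (r j) t.
  by rewrite ij mulrA.
Qed.

End Commutant.

(** * Closures of unitary orbits *)

Section AFAlgebras.
Variables (R : realType) (A : completeNormedModType R[i]) (SA : cstar_structure A).
Local Notation T := (calg SA).

(* The subalgebras in the definition of [AF] need not contain the unit. *)
Definition adjoin1 (D : set T) : set T :=
  [set x : T | exists (c : R[i]) (d : T), D d /\ x = c *: (1 : T) + d].

Lemma sub_adjoin1 D : D `<=` adjoin1 D.
Proof. by move=> x Dx; exists 0, x; rewrite scale0r add0r. Qed.

Lemma adjoin1S D E : D `<=` E -> adjoin1 D `<=` adjoin1 E.
Proof. by move=> DE x [c [d [Dd ->]]]; exists c, d; split=> //; exact: DE. Qed.

Lemma fd_subalgebra_adjoin1 (D : set A) :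
  fd_star_subalgebra SA D -> fd_subalgebra (adjoin1 D).
Proof.
move=> [[s DE] [DM Dstar]].
have DM' (x y : T) : D x -> D y -> D (x * y) := DM x y.
have Dstar' (x : T) : D x -> D (star x) := Dstar x.
pose s' i : T := s`_i.
have sp (x : T) : D x <-> exists c : 'I_(size s) -> R[i], x = \sum_i c i *: s' i.
  by rewrite DE.
have DD (x y : T) : D x -> D y -> D (x + y).
  move=> /sp[c ->] /sp[d ->]; apply/sp; exists (fun i => c i + d i).
  by rewrite -big_split; apply: eq_bigr => i _; rewrite scalerDl.
have DZ a (x : T) : D x -> D (a *: x).
  move=> /sp[c ->]; apply/sp; exists (fun i => a * c i).
  by rewrite scaler_sumr; apply: eq_bigr => i _; rewrite scalerA.
have Ds (i : 'I_(size s)) : D (s' i).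
  apply/sp; exists (fun j => (j == i)%:R); rewrite (bigD1 i)//= eqxx scale1r.
  by rewrite big1 ?addr0// => j /negbTE ->; rewrite scale0r.
have D0 : D (0 : T).
  apply/sp; exists (fun=> 0); rewrite big1// => i _; by rewrite scale0r.
split.
- exists (size s).+1, (fun j => if unlift ord0 j is Some i then s' i else 1); split.
    move=> j; case: unliftP => [i|] _; last by exists 1, 0; rewrite scale1r addr0.
    exact/sub_adjoin1/Ds.
  move=> x [c [d [/sp[e ->] ->]]].
  exists (fun j => if unlift ord0 j is Some i then e i else c).
  rewrite big_ord_recl unlift_none; congr (_ + _); apply: eq_bigr => i _.
  by rewrite liftK.
- by exists 1, 0; rewrite scale1r addr0.
- move=> x y [c [d [Dd ->]]] [c' [d' [Dd' ->]]]; exists (c + c'), (d + d').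
  by split; [exact: DD|rewrite scalerDl addrACA].
- move=> a x [c [d [Dd ->]]]; exists (a * c), (a *: d).
  by split; [exact: DZ|rewrite scalerDr scalerA].
- move=> x y [c [d [Dd ->]]] [c' [d' [Dd' ->]]].
  exists (c * c'), (c *: d' + (c' *: d + d * d')); split.
    by apply: (DD); [exact: DZ|apply: (DD); [exact: DZ|exact: DM']].
  rewrite mulrDl !mulrDr !scale_mull !scale_mulr !mul1r mulr1 scalerA.
  by rewrite -addrA.
- move=> x [c [d [Dd ->]]]; exists (c^*)%C, (star d); split; first exact: Dstar'.
  by rewrite starD starZ star1.
Qed.

Lemma AF_fd_subalgebras : AF SA -> exists E : nat -> set T,
  [/\ forall n, fd_subalgebra (E n), forall m n, (m <= n)%N -> E m `<=` E n &
    forall (a : T) (e : R), 0 < e -> exists n b, E n b /\ nrm (a - b) < e].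
Proof.
move=> [D [fD [DS Dd]]]; exists (fun n => adjoin1 (D n)); split.
- by move=> n; exact: fd_subalgebra_adjoin1.
- move=> m n mn; apply: adjoin1S; elim: n mn => [|n IH].
    by rewrite leqn0 => /eqP ->.
  rewrite leq_eqVlt ltnS => /orP[/eqP -> //|/IH h].
  exact: subset_trans h (DS n).
- move=> a e e0; have : closure (\bigcup_n D n) (a : A) by rewrite Dd.
  move=> /(_ [set b : A | nrm ((a : A) - b) < e])[|b [[n _ Db] ab]].
    by apply/nbhs_nrmP; exists e.
  by exists n, b; split=> //; exact: sub_adjoin1.
Qed.

End AFAlgebras.

(** * Conjugation, pointwise limits and orbit closures *)

Section Orbits.
Variables (R : realType) (A B : completeNormedModType R[i]).
Variables (SA : cstar_structure A) (SB : cstar_structure B).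
Local Notation TA := (calg SA).
Local Notation TB := (calg SB).

Definition conj_by (U : TB) (f : TA -> TB) : TA -> TB :=
  fun a => star U * f a * U.

Lemma conj_by_star_hom U f : unitary U -> star_hom f -> star_hom (conj_by U f).
Proof.
move=> [u1 u2] hf; split; rewrite /conj_by.
- by move=> x y; rewrite (star_homD hf) mulrDr mulrDl.
- by move=> a x; rewrite (star_homZ hf) scale_mulr scale_mull.
- move=> x y; rewrite (star_homM hf) -!mulrA; congr (_ * (_ * _)).
  by rewrite (mulrA U) u2 mul1r.
- by move=> x; rewrite (star_hom_star hf) !starM starK mulrA.
- by rewrite (star_hom1 hf) mulr1.
Qed.

Lemma cvg_nrmP (I : Type) (F : set_system I) (g : I -> B) (l : B) : Filter F ->
  (g @ F --> l) <-> forall e : R, 0 < e -> \forall i \near F, nrm (l - g i) < e.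
Proof.
move=> FF; split=> [/cvgrPdist_lt h e e0|h].
  have /h : 0 < e%:C%C by rewrite ltcR.
  by apply: filterS => i; rewrite normE ltcR.
apply/cvgrPdist_lt => e e0; have eE : e = (complex.Re e)%:C%C.
  by rewrite RRe_real// gtr0_real.
have : 0 < complex.Re e by rewrite -ltcR -eE.
by move=> /h; apply: filterS => i; rewrite normE eE ltcR.
Qed.

Lemma ptws_cvg_nrmP (I : Type) (F : set_system I) (g : I -> {ptws A -> B})
    (l : {ptws A -> B}) : Filter F ->
  (g @ F --> l) <->
  forall a (e : R), 0 < e -> \forall i \near F, nrm (l a - g i a) < e.
Proof.
move=> FF; split.
  move=> /pointwise_cvgP h a; apply/cvg_nrmP; exact: h.
by move=> h; apply/pointwise_cvgP => a; apply/(cvg_nrmP (fun i => g i a)) => e; exact: h.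
Qed.

(** Finitely many evaluation constraints define a neighbourhood for pointwise convergence. *)
Lemma closure_orbit_approx (pi f : A -> B) n (a : 'I_n -> A) (e : R) :
  closure (unitary_orbit SB pi) f -> 0 < e ->
  exists U : TB, unitary U /\
    forall i, nrm ((f (a i) : TB) - conj_by U pi (a i)) < e.
Proof.
move=> clf e0.
have : nbhs (f : {ptws A -> B}) [set g : {ptws A -> B} |
    forall i, nrm (f (a i) - g (a i)) < e].
  apply: (@filter_forall _ _ (fun i (g : {ptws A -> B}) => nrm (f (a i) - g (a i)) < e)
    _ (nbhs_filter (f : {ptws A -> B}))) => i.
  have /ptws_cvg_nrmP :
      (id : {ptws A -> B} -> _) @ nbhs (f : {ptws A -> B}) --> (f : {ptws A -> B}).
    exact: cvg_id.
  exact.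
by move=> /clf[g [[U [uU ->]] h]]; exists U.
Qed.

(** Conjugation by [U] is continuous for pointwise convergence and maps the orbit into itself,
    replacing [W] by [W * U]. *)
Lemma closure_orbit_conj (pi f : A -> B) (U : TB) : unitary U ->
  closure (unitary_orbit SB pi) f ->
  closure (unitary_orbit SB pi) (conj_by U f : A -> B).
Proof.
move=> uU clf N NU.
have : nbhs (f : {ptws A -> B}) [set g : {ptws A -> B} | N (conj_by U g)].
  suff h : (conj_by U : {ptws A -> B} -> {ptws A -> B}) @ nbhs (f : {ptws A -> B}) -->
      (conj_by U f : {ptws A -> B}) by exact: h.
  apply/ptws_cvg_nrmP => a e e0.
  have /ptws_cvg_nrmP/(_ a e e0) :
      (id : {ptws A -> B} -> _) @ nbhs (f : {ptws A -> B}) --> (f : {ptws A -> B}).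
    exact: cvg_id.
  apply: filterS => g; apply: le_lt_trans.
  have := nrm_conj ((f a : TB) - g a) uU.
  by rewrite mulrBr mulrBl.
move=> /clf[_ [[W [uW ->]] NW]]; exists (conj_by U (conj_by W pi)); split=> //.
exists ((W : TB) * U); split; first exact: unitaryM.
apply/funext => a; rewrite -[RHS]/(star ((W : TB) * U) * (pi a : TB) * ((W : TB) * U)).
by rewrite /conj_by starM !mulrA.
Qed.

Lemma closure_orbit_seq (pi : A -> B) (g : nat -> A -> B) (l : A -> B) :
  (forall n, closure (unitary_orbit SB pi) (g n)) ->
  (forall a (e : R), 0 < e -> exists M, forall N, (M <= N)%N -> nrm (g N a - l a) < e) ->
  closure (unitary_orbit SB pi) l.
Proof.
move=> gcl gl.
have h : (g : nat -> {ptws A -> B}) @ \oo --> (l : {ptws A -> B}).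
  apply/ptws_cvg_nrmP => a e e0; have [M hM] := gl a e e0.
  by exists M => // N /= MN; rewrite nrm_distC; exact: hM.
have := @closed_cvg _ _ _ eventually_filter (g : nat -> {ptws A -> B})
  (closure (unitary_orbit SB pi)) (@closed_closure _ _).
by apply; [exact: nearW|exact: h].
Qed.

Lemma nrm_small_eq0_mul (K : R) (z : B) : 0 <= K ->
  (forall e, 0 < e -> nrm z <= K * e) -> z = 0.
Proof.
move=> K0 h; apply: nrm_small_eq0 => e e0.
have K1 : 0 < K + 1 by rewrite ltr_wpDl.
apply: (le_trans (h (e / (K + 1)) _)); first exact: divr_gt0.
by rewrite mulrCA ler_piMr ?ltW// ltr_pdivrMr// mul1r ltrDl.
Qed.

Lemma star_hom_limit (g : nat -> TA -> TB) (l : TA -> TB) :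
  (forall n, star_hom (g n)) ->
  (forall a (e : R), 0 < e -> exists M, forall N, (M <= N)%N -> nrm (g N a - l a) < e) ->
  star_hom l.
Proof.
move=> hg gl.
have gl3 a b c (e : R) : 0 < e -> exists N, [/\ nrm (g N a - l a) < e,
    nrm (g N b - l b) < e & nrm (g N c - l c) < e].
  move=> e0; have [M1 h1] := gl a e e0; have [M2 h2] := gl b e e0.
  have [M3 h3] := gl c e e0; exists (maxn M1 (maxn M2 M3)).
  by split; [apply: h1|apply: h2|apply: h3]; rewrite !leq_max leqnn ?orbT.
split.
- move=> x y; apply/eqP; rewrite -subr_eq0; apply/eqP.
  apply: (@nrm_small_eq0_mul 3) => // e /(gl3 (x + y) x y)[N [h1 h2 h3]].
  have -> : l (x + y) - (l x + l y) =
      (l (x + y) - g N (x + y)) + ((g N x - l x) + (g N y - l y)).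
    by rewrite (addrACA (g N x)) -opprD -(star_homD (hg N)) subrKA.
  have := nrmD (l (x + y) - g N (x + y)) ((g N x - l x) + (g N y - l y)).
  have := nrmD (g N x - l x) (g N y - l y).
  by move: h1; rewrite nrm_distC; lra.
- move=> a x; apply/eqP; rewrite -subr_eq0; apply/eqP.
  have a0 : 0 <= complex.Re `|a| by rewrite -ler0c RRe_real// ger0_real.
  apply: (@nrm_small_eq0_mul (1 + complex.Re `|a|)); first by rewrite addr_ge0.
  move=> e /(gl3 (a *: x) x x)[N [h1 h2 _]].
  have -> : l (a *: x) - a *: l x =
      (l (a *: x) - g N (a *: x)) + a *: (g N x - l x).
    by rewrite scalerBr -(star_homZ (hg N)) subrKA.
  rewrite [leRHS]mulrDl mul1r (le_trans (nrmD _ _))// lerD//.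
    by rewrite nrm_distC ltW.
  by rewrite nrmZ ler_wpM2l// ltW.
- move=> x y; apply/eqP; rewrite -subr_eq0; apply/eqP.
  (* The summand [nrm x] bounds [g N x] for every [N], by contractivity. *)
  apply: (@nrm_small_eq0_mul (1 + (nrm x + nrm (l y)))).
    by rewrite !addr_ge0 ?nrm_ge0.
  move=> e /(gl3 (x * y) x y)[N [h1 h2 h3]].
  have -> : l (x * y) - l x * l y = (l (x * y) - g N (x * y)) +
      (g N x * (g N y - l y) + (g N x - l x) * l y).
    by rewrite mulrBr mulrBl -(star_homM (hg N)) subrKA subrKA.
  rewrite [leRHS]mulrDl mul1r (le_trans (nrmD _ _))// lerD//.
    by rewrite nrm_distC ltW.
  rewrite [leRHS]mulrDl (le_trans (nrmD _ _))// lerD//.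
    by apply: nrm_le_mul; [exact: star_hom_contractive|exact: ltW].
  by rewrite mulrC; apply: nrm_le_mul; [exact: ltW|].
- move=> x; apply/eqP; rewrite -subr_eq0; apply/eqP.
  apply: (@nrm_small_eq0_mul 2) => // e /(gl3 (star x) x x)[N [h1 h2 _]].
  have -> : l (star x) - star (l x) =
      (l (star x) - g N (star x)) + star (g N x - l x).
    by rewrite starB -(star_hom_star (hg N)) subrKA.
  have := nrmD (l (star x) - g N (star x)) (star (g N x - l x)).
  by move: h1; rewrite nrm_star nrm_distC; lra.
- apply/eqP; rewrite -subr_eq0; apply/eqP.
  apply: (@nrm_small_eq0_mul 1) => // e /(gl3 1 1 1)[N [h1 _ _]].
  by move: h1; rewrite (star_hom1 (hg N)) nrm_distC mul1r => /ltW.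
Qed.

Lemma uniform_limit_exists (g : nat -> R -> A -> B) :
  (forall a (e : R), 0 < e ->
    exists M, forall N t, (M <= N)%N -> nrm (g N t a - g M t a) < e) ->
  exists F : R -> A -> B, forall a (e : R), 0 < e ->
    exists M, forall N t, (M <= N)%N -> nrm (g N t a - F t a) < e.
Proof.
move=> gC.
have /choice[F FP] : forall ta : R * A, exists l : B, forall e : R, 0 < e ->
    exists M, forall N, (M <= N)%N -> nrm (g N ta.1 ta.2 - l) < e.
  move=> [t a]; apply: nrm_cauchy => e e0; have [M hM] := gC a e e0.
  by exists M => N; exact: hM.
exists (fun t a => F (t, a)) => a e e0; have e3 : 0 < e / 3 by rewrite divr_gt0.
have [M hM] := gC a _ e3; exists M => N t MN.
(* The index [M'] depends on [t] but serves only as an intermediate point; the resulting [M] does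
   not depend on [t]. *)
have [M' hM'] := FP (t, a) _ e3.
have := hM' _ (leq_maxl M' M) => /= h1.
have h2 := hM _ t (leq_maxr M' M); have h3 := hM _ t MN.
have := nrm_dist_le (g M t a) (g N t a) (F (t, a)).
have := nrm_dist_le (g (maxn M' M) t a) (g M t a) (F (t, a)).
by rewrite (nrm_distC (g M t a) (g (maxn M' M) t a)); lra.
Qed.

End Orbits.

(** * The path between two points of the orbit closure *)

Section Main.
Variables (R : realType) (A B : completeNormedModType R[i]).
Variables (SA : cstar_structure A) (SB : cstar_structure B).
Local Notation TA := (calg SA).
Local Notation TB := (calg SB).

Lemma lipschitz_path_star (g : R -> TB) : lipschitz_path g ->
  lipschitz_path (fun t => star (g t)).
Proof. by move=> [L [L0 gL]]; exists L; split=> // s t; rewrite -starB nrm_star. Qed.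

Lemma unitary_path_from1 (U : TB) : HUC SB -> unitary U ->
  exists g : R -> TB, [/\ lipschitz_path g, forall t, unitary (g t), g 0 = 1 & g 1 = U].
Proof.
move=> hucB uU.
have cU : corner_unitary 1 U.
  by have := corner_unitary_commute (projection1 _) uU; rewrite mulr1 mul1r; apply.
have [|g [gL gu g0 g1]] := corner_path_connected (projection1 _) _ cU.
  exact: (hucB (1 : TB) (projection1 _)).
by exists g; split=> // t; have [_ []] := gu t.
Qed.

(** Near the generators [v i], [x] and [y] look like conjugates of [pi] by [z1] and [z2], so
    conjugating [x] by [star z1 * z2] brings it close to [y]. Each approximation takes half of the
    tolerance of [close_homs_equivalent], which then makes the equivalence exact. *)
Lemma equivalent_on_fd (pi x y : TA -> TB) (D : set TA) :
  star_hom x -> star_hom y -> fd_subalgebra D ->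
  closure (unitary_orbit SB (pi : A -> B)) (x : A -> B) ->
  closure (unitary_orbit SB (pi : A -> B)) (y : A -> B) ->
  exists V, unitary V /\ forall a, D a -> x a * V = V * y a.
Proof.
move=> hx hy fD clx cly; have [n [r [v vD]]] := exists_matrix_units fD.
have e0 : 0 < (8 * n.+1%:R)^-1 / 2 :> R by rewrite divr_gt0// invr_gt0 mulr_gt0.
have [z1 [u1 h1]] := closure_orbit_approx SA v clx e0.
have [z2 [u2 h2]] := closure_orbit_approx SA v cly e0.
pose z := star z1 * z2; have uz : unitary z by exact: unitaryM (unitary_star u1) u2.
have [|U [uU hU]] := close_homs_equivalent fD vD (conj_by_star_hom uz hx) hy.
  (* [C] is the error of the first approximation, carried back by [z1]; conjugations do not increase
     its norm. *)
  move=> i; pose C := conj_by (star z1) (fun a => conj_by z1 pi a - x a).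
  have CE : conj_by z2 pi (v i) - conj_by z x (v i) = conj_by z2 C (v i).
    rewrite /C /conj_by /z !(mulrBr, mulrBl) starM !starK !mulrA.
    rewrite -(mulrA (star z2) z1 (star z1)) (proj2 u1) mulr1.
    by rewrite -(mulrA _ z1 (star z1)) (proj2 u1) mulr1.
  have C2 : nrm (conj_by z2 C (v i)) <= nrm (C (v i)) := nrm_conj _ u2.
  have C1 : nrm (C (v i)) <= nrm (conj_by z1 pi (v i) - x (v i)).
    exact: (nrm_conj _ (unitary_star u1)).
  have := nrm_dist_le (conj_by z2 pi (v i)) (y (v i)) (conj_by z x (v i)).
  rewrite CE; move: (h1 i) (h2 i) C1 C2; rewrite (nrm_distC (x (v i))).
  by move: (8 * _)^-1 => d; lra.
clearbody z.
have hUz a : D a -> U * star z * x a = y a * (U * star z).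
  by move=> Da; rewrite mulrA -hU// /conj_by -!mulrA (proj2 uz) mulr1.
have uV := unitaryM uU (unitary_star uz).
exists (star (U * star z)); split; first exact: unitary_star.
move=> a Da; have := congr1 (@star _ _ SB) (hUz (star a) (fd_star fD Da)).
by rewrite !starM (star_hom_star hx) (star_hom_star hy) !starK.
Qed.

Lemma conj_by_commute (f : TA -> TB) (X G : TB) a : unitary X ->
  X * f a = f a * X -> conj_by (X * G) f a = conj_by G f a.
Proof.
move=> [X1 _] Xf; rewrite /conj_by starM -!mulrA (mulrA (f a)) -Xf.
by rewrite -(mulrA X) (mulrA (star X)) X1 mul1r.
Qed.

Lemma path_between (pi x y : TA -> TB) : AF SA -> HUC SB ->
  star_hom x -> star_hom y ->
  closure (unitary_orbit SB (pi : A -> B)) (x : A -> B) ->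
  closure (unitary_orbit SB (pi : A -> B)) (y : A -> B) ->
  exists F : R -> {ptws A -> B}, [/\ continuous F, F 0 = x, F 1 = y &
    forall t, closure (unitary_orbit SB (pi : A -> B)) (F t) /\
      star_hom (F t : TA -> TB)].
Proof.
move=> AFA hucB hx hy clx cly; have [E [fE EE Ed]] := AF_fd_subalgebras AFA.
have /choice[V VP] : forall n, exists V, unitary V /\ forall a, E n a -> x a * V = V * y a.
  by move=> n; exact: equivalent_on_fd clx cly.
have uV n : unitary (V n) := (VP n).1.
have xV n a : E n a -> x a * V n = V n * y a := (VP n).2 a.
have Vx n a : E n a -> star (V n) * x a = y a * star (V n).
  move=> Ea; have := congr1 (@star _ _ SB) (xV n (star a) (fd_star (fE n) Ea)).
  by rewrite !starM (star_hom_star hx) (star_hom_star hy) !starK.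
have /choice[W WP] : forall n, exists W : R -> TB,
    [/\ lipschitz_path W, forall t, unitary (W t), W 0 = 1,
      W 1 = V n.+1 * star (V n) & forall t a, E n a -> W t * x a = x a * W t].
  move=> n; have [m [r [v vE]]] := exists_matrix_units (fE n).
  apply: (commutant_unitary_path (fE n) vE hucB hx).
    exact: unitaryM (uV _) (unitary_star (uV _)).
  (* [star (V n)] turns [x a] into [y a] and [V n.+1] turns it back, because [a] also lies in
     [E n.+1]. *)
  move=> a Ea; rewrite -mulrA Vx// mulrA -xV ?mulrA//.
  exact: EE Ea.
have [G0 [G0L G0u G00 G01]] := unitary_path_from1 hucB (uV 0%N).
(* The new factor goes on the left, next to [x a] in the conjugation, where it cancels for [a] in
   [E m]. *)
pose G := fix G n (t : R) : TB := if n is m.+1 then W m t * G m t else G0 t.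
have GP n : [/\ lipschitz_path (G n), forall t, unitary (G n t), G n 0 = 1 & G n 1 = V n].
  elim: n => [|n [GL Gu Gz Go]]; first by split.
  have [WL Wu Wz Wo _] := WP n; split=> /=.
  - by apply: lipschitz_pathM WL GL => t; apply: nrm_unitary_le1.
  - by move=> t; exact: unitaryM.
  - by rewrite Wz Gz mulr1.
  - by rewrite Wo Go -mulrA (proj1 (uV n)) mulr1.
have Gu n t : unitary (G n t) by have [_ h _ _] := GP n.
pose g n t := conj_by (G n t) x.
have gh n t : star_hom (g n t) := conj_by_star_hom (Gu n t) hx.
have gE M N t a : (M <= N)%N -> E M a -> g N t a = g M t a.
  move=> + Ea; elim: N => [|N IH]; first by rewrite leqn0 => /eqP ->.
  rewrite leq_eqVlt ltnS => /orP[/eqP ->//|MN]; rewrite -IH// /g /=.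
  have [_ Wu _ _ Wx] := WP N.
  by apply: conj_by_commute => //; apply: Wx; exact: EE Ea.
have [F FP] : exists F : R -> TA -> TB, forall a (e : R), 0 < e ->
    exists M, forall N t, (M <= N)%N -> nrm (g N t a - F t a) < e.
  apply: (uniform_limit_exists (g := g)) => a e e0.
  have e2 : 0 < e / 2 by rewrite divr_gt0.
  have [M [b [Eb ab]]] := Ed a _ e2; exists M => N t MN.
  (* The two homomorphisms agree at [b], so only [a - b] counts, and contractivity bounds the
     difference by twice its norm, independently of [t]. *)
  have -> : g N t a - g M t a = g N t (a - b) - g M t (a - b).
    by rewrite !(star_homB (gh _ _)) (gE _ _ _ _ MN Eb) opprB addrC addrA subrK addrC.
  have := nrmB (g N t (a - b)) (g M t (a - b)).
  have := star_hom_contractive (gh N t) (a - b).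
  have := star_hom_contractive (gh M t) (a - b); lra.
(* Uniqueness of limits, used to identify both endpoints of the path. *)
have Fu t (f : TA -> TB) : (forall a (e : R), 0 < e ->
    exists M, forall N, (M <= N)%N -> nrm (g N t a - f a) < e) -> F t = f.
  move=> gf; apply/funext => a; apply/eqP; rewrite -subr_eq0; apply/eqP.
  apply: (@nrm_small_eq0_mul _ _ 2) => // e e0; have [M1 h1] := FP a e e0.
  have [M2 h2] := gf a e e0.
  have := nrm_dist_le (g (maxn M1 M2) t a) (F t a) (f a).
  have := h1 _ t (leq_maxl M1 M2); have := h2 _ (leq_maxr M1 M2).
  by rewrite (nrm_distC (F t a) (g _ t a)); lra.
exists F; split.
- move=> t; apply/ptws_cvg_nrmP => a e e0.
  suff : \forall s \near t, nrm ((F t a : TB) - F s a) < e by [].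
  have e3 : 0 < e / 3 by rewrite divr_gt0.
  have [M hM] := FP a _ e3.
  have [L [L0 gL]] : lipschitz_path (fun t => g M t a).
    have [GL _ _ _] := GP M.
    apply: (@lipschitz_pathM _ _ _ _ _ (nrm (x a)) 1) => //.
    - move=> s; rewrite -[leRHS]mul1r; apply: nrm_le_mul => //.
      by rewrite nrm_star; exact: nrm_unitary_le1.
    - by move=> s; exact: nrm_unitary_le1.
    - apply: (@lipschitz_path_mulr _ _ _ _ _ 1); last exact: lipschitz_path_star.
      by move=> s; rewrite nrm_star; exact: nrm_unitary_le1.
  have L1 : 0 < L + 1 by rewrite ltr_wpDl.
  have d0 : 0 < e / 3 / (L + 1) by rewrite divr_gt0.
  have : \forall s \near t, `|t - s| < e / 3 / (L + 1).
    by apply/nbhs_ballP; exists (e / 3 / (L + 1)).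
  apply: filterS => s ts.
  have gts : nrm (g M t a - g M s a) < e / 3.
    rewrite (le_lt_trans (gL t s))// (le_lt_trans (y := (L + 1) * `|t - s|))//.
      by rewrite ler_wpM2r// lerDl.
    by rewrite mulrC -ltr_pdivlMr.
  have := hM _ t (leqnn M); have := hM _ s (leqnn M).
  have := nrm_dist_le (g M t a) (F t a) (F s a).
  have := nrm_dist_le (g M s a) (g M t a) (F s a).
  by rewrite (nrm_distC (F t a) (g M t a)); lra.
- apply: Fu => a e e0; exists 0%N => N _; have [_ _ Gz _] := GP N.
  by rewrite /g /conj_by Gz star1 mul1r mulr1 subrr nrm0.
- apply: Fu => a e e0; have e2 : 0 < e / 2 by rewrite divr_gt0.
  have [M [b [Eb ab]]] := Ed a _ e2; exists M => N MN.
  (* At parameter 1 the conjugating unitary is [V N], which carries [x] to [y] on [E N]. *)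
  have gNb : g N 1 b = y b.
    have [_ _ _ Go] := GP N; rewrite /g /conj_by Go -mulrA xV; last exact: EE Eb.
    by rewrite mulrA (proj1 (uV N)) mul1r.
  have -> : g N 1 a - y a = g N 1 (a - b) - y (a - b).
    by rewrite (star_homB (gh _ _)) (star_homB hy) gNb opprB addrC addrA subrK addrC.
  have := nrmB (g N 1 (a - b)) (y (a - b)).
  have := star_hom_contractive (gh N 1) (a - b).
  have := star_hom_contractive hy (a - b); lra.
move=> t; have gl a (e : R) : 0 < e ->
    exists M, forall N, (M <= N)%N -> nrm (g N t a - F t a) < e.
  by move=> /(FP a)[M hM]; exists M => N; exact: hM.
split; last exact: star_hom_limit gl.
apply: (closure_orbit_seq (g := fun n => g n t : A -> B) _ gl) => n.
exact: closure_orbit_conj.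
Qed.

End Main.

Theorem mainTheorem2 (R : realType) (A B : completeNormedModType R[i])
  (SA : cstar_structure A) (SB : cstar_structure B) (pi : A -> B) :
  separable A -> AF SA -> HUC SB -> Rep SA SB pi ->
  path_connected R (unitary_orbit_closure SA SB pi).
Proof.
move=> _ AFA hucB _ x y [clx /unital_star_homP hx] [cly /unital_star_homP hy].
have [F [cF F0 F1 FS]] := path_between AFA hucB hx hy clx cly.
exists F; split; first exact: continuous_subspaceT.
split=> //; split=> // _ [t _ <-]; have [clF hF] := FS t; split=> //.
exact/unital_star_homP.
Qed.
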